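(* Let $\Omega\subset\mathbb{R}^N$, $N\ge1$, be a bounded open set, let $A$ satisfy (A) and let $F$ satisfy (F1) and (F2) of the context. Assume moreover that $F$ is ''almost nonincreasing'' in $s$, in the following sense: denoting by $\lambda_1$ the first eigenvalue of the operator $-\operatorname{div}\,A^{s}(x)D$ in $H^1_0(\Omega)$, where $A^{s}(x)=(A(x)+{}^tA(x))/2$ is the symmetrized part of $A(x)$, there exists $\lambda$ with $0\le\lambda<\lambda_1$ such that $$F(x,s)-\lambda s\le F(x,t)-\lambda t\quad\text{for a.e. }x\in\Omega,\ \forall s,t \text{ with } 0\le t\le s .$$ Then the solution (in the sense defined in the context) to the problem $$-\operatorname{div} A(x)Du=F(x,u)\ \text{ in }\Omega,\qquad u=0\ \text{ on }\partial\Omega$$ is unique.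
   Context: $\Omega$ is a bounded open subset of $\mathbb{R}^N$, $N\ge1$, with no regularity assumed on $\partial\Omega$. $D$ denotes the gradient, and $A(x)Du\,D\varphi$ means $(A(x)Du)\cdot D\varphi$. (A) $A\in L^\infty(\Omega)^{N\times N}$ and there is $\alpha>0$ with $A(x)\ge\alpha I$ for a.e. $x\in\Omega$, i.e. $A(x)\xi\cdot\xi\ge\alpha|\xi|^2$ for all $\xi\in\mathbb{R}^N$. (F1) $F:\Omega\times[0,+\infty[\to[0,+\infty]$ is a Carathéodory function: for a.e. $x\in\Omega$ the map $s\in[0,+\infty[\mapsto F(x,s)\in[0,+\infty]$ is continuous, and for every $s\in[0,+\infty[$ the map $x\mapsto F(x,s)\in[0,+\infty]$ is measurable. (F2) There exist $\gamma$ with $0<\gamma\le1$ and $h\in L^r(\Omega)$, $h\ge0$ a.e., where $r=\frac{2N}{N+2}$ if $N\ge3$, $r>1$ if $N=2$, $r=1$ if $N=1$, such that $0\le F(x,s)\le h(x)\left(\frac1{s^\gamma}+1\right)$ for a.e. $x\in\Omega$ and all $s>0$. Definition of solution: $u$ is a solution to the problem if $u\in H^1_0(\Omega)$, $u\ge0$ a.e. in $\Omega$, and for every $\varphi\in H^1_0(\Omega)$ with $\varphi\ge0$ one has $$\int_\Omega F(x,u)\varphi<+\infty\quad\text{and}\quad\int_\Omega A(x)Du\,D\varphi=\int_\Omega F(x,u)\varphi .$$ (Integrals of nonnegative measurable functions with values in $[0,+\infty]$ are elements of $[0,+\infty]$, with the usual convention $0\cdot\infty=0$.) *)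

(* Defs.v *)
(* The ambient space is R^N with N = n.+1 >= 1; its points are row vectors,
   gradients are column vectors. *)
From HB Require Import structures.
From mathcomp Require Import all_boot all_order all_algebra.
From mathcomp Require Import all_classical all_reals all_analysis.
From mathcomp Require Import measurable_realfun.

Set Implicit Arguments.
Unset Strict Implicit.
Unset Printing Implicit Defensive.

Import Order.TTheory GRing.Theory Num.Theory.
Import numFieldNormedType.Exports.

Local Open Scope classical_set_scope.
Local Open Scope ring_scope.

Section lebesgue_measure_rV.
Variables (R : realType) (n : nat).
Local Notation T := 'rV[R]_n.+1.
Implicit Types (b : T * T) (A : set T).

Definition box b : set T :=
  [set x | forall i, b.1 ord0 i <= x ord0 i < b.2 ord0 i].

(* The cut-off at 0 makes the volume of an empty box vanish. *)
Definition box_volume b : \bar R :=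
  (\prod_(i < n.+1) Num.max 0 (b.2 ord0 i - b.1 ord0 i))%:E.

Definition box_cover A : set (nat -> T * T) :=
  [set I | A `<=` \bigcup_k box (I k)].

Definition lebesgue_outer A : \bar R :=
  ereal_inf [set (\sum_(k <oo) box_volume (I k))%E | I in box_cover A].

Local Open Scope ereal_scope.

Lemma box_volume_ge0 b : 0 <= box_volume b.
Proof. by rewrite lee_fin prodr_ge0// => i _; rewrite le_max lexx. Qed.

Lemma lebesgue_outer_ge0 A : 0 <= lebesgue_outer A.
Proof.
apply: le_ereal_inf_tmp => _ [I _ <-].
by apply: nneseries_ge0 => k _ _; exact: box_volume_ge0.
Qed.

Lemma lebesgue_outer0 : lebesgue_outer set0 = 0.
Proof.
apply/eqP; rewrite eq_le lebesgue_outer_ge0 andbT.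
apply: ereal_inf_lbound; exists (fun=> (0%R, 0%R)); first by move=> ? [].
apply: eseries0 => k _ _; rewrite /box_volume big_ord_recl/= !mxE subrr maxxx.
by rewrite mul0r.
Qed.

Lemma le_lebesgue_outer :
  {homo lebesgue_outer : A B / A `<=` B >-> A <= B}.
Proof.
move=> A B AB; apply: ereal_inf_le_tmp => _ [I BI <-].
by exists I => //; exact: subset_trans BI.
Qed.

Lemma lebesgue_outer_sigma_subadditive : sigma_subadditive lebesgue_outer.
Proof.
move=> A; have [[i ioo]|] := pselect (exists i, lebesgue_outer (A i) = +oo).
  rewrite (eseries_pinfty _ _ ioo) ?leey// => k _.
  by rewrite -ltNye (lt_le_trans _ (lebesgue_outer_ge0 _)).
rewrite -forallNE => Aoo.
apply/lee_addgt0Pr => e e0.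
rewrite (le_trans _ (epsilon_trick _ _ (ltW e0)))//; last first.
  by move=> k; exact: lebesgue_outer_ge0.
pose P k (I : nat -> T * T) := box_cover (A k) I /\
  \sum_(j <oo) box_volume (I j) <=
    lebesgue_outer (A k) + (e / (2 ^ k.+1)%:R)%:E.
have [G PG] : {G : nat -> nat -> T * T & forall k, P k (G k)}.
  apply: (@choice _ _ P) => k.
  have Afin : lebesgue_outer (A k) \is a fin_num.
    by rewrite ge0_fin_numE ?lebesgue_outer_ge0// ltey; apply/eqP/Aoo.
  have ek : (0 < e / (2 ^ k.+1)%:R)%R.
    by rewrite divr_gt0// ltr0n expn_gt0.
  have [_ [I AI <-] /ltW Ie] := lb_ereal_inf_adherent ek Afin.
  by exists I.
have /card_esym/ppcard_eqP[f] := card_nat2.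
apply: (@le_trans _ _ (\esum_(p in setT) box_volume (G p.1 p.2))).
  apply: ereal_inf_lbound; exists (fun k => G (f k).1 (f k).2).
    move=> t [i _ /(PG i).1 [j _ tij]].
    by exists (f^-1%FUN (i, j)) => //=; rewrite invK ?inE.
  rewrite (reindex_esum [set: nat] _ f)//.
  by rewrite nneseries_esumT// => k; exact: box_volume_ge0.
rewrite (_ : [set: nat * nat] = setT `*`` (fun=> setT)); last first.
  by apply/seteqP; split.
rewrite -(@esum_esum _ _ _ setT (fun=> setT) (fun i j => box_volume (G i j)))//;
  last by move=> *; exact: box_volume_ge0.
rewrite -nneseries_esumT; last first.
  by move=> i; apply: esum_ge0 => j _; exact: box_volume_ge0.
apply: lee_nneseries => i _.
  by move=> _; apply: esum_ge0 => j _; exact: box_volume_ge0.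
by rewrite -nneseries_esumT => [|j]; [exact: (PG i).2|exact: box_volume_ge0].
Qed.

HB.instance Definition _ := isOuterMeasure.Build R T lebesgue_outer
  lebesgue_outer0 lebesgue_outer_ge0 le_lebesgue_outer
  lebesgue_outer_sigma_subadditive.

End lebesgue_measure_rV.

(* 'rV[R]_N carries the (complete) sigma-algebra of Lebesgue measurable sets,
   in the sense of Caratheodory. *)
HB.instance Definition _ (R : realType) (n : nat) :=
  Measurable.copy 'rV[R]_n.+1 (caratheodory_type (@lebesgue_outer R n)).

Definition lebesgue_rV (R : realType) (n : nat) : set 'rV[R]_n.+1 -> \bar R :=
  @lebesgue_outer R n.

HB.instance Definition _ (R : realType) (n : nat) :=
  isMeasure.Build _ 'rV[R]_n.+1 R (@lebesgue_rV R n)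
    (@caratheodory_measure0 _ _ (@lebesgue_outer R n))
    (@caratheodory_measure_ge0 _ _ (@lebesgue_outer R n))
    (@caratheodory_measure_sigma_additive _ _ (@lebesgue_outer R n)).

Section sobolev.
Variables (R : realType) (n : nat).
Local Notation T := 'rV[R]_n.+1.
Local Notation leb := (@lebesgue_rV R n).
Implicit Types (Omega : set T) (u phi : T -> R) (g Du Dphi : T -> 'cV[R]_n.+1).

Definition partial (i : 'I_n.+1) phi : T -> R :=
  fun x => 'D_(delta_mx ord0 i) phi x.

Fixpoint Ck (k : nat) phi : Prop :=
  continuous phi /\
  if k is k'.+1 then
    forall i, (forall x, derivable phi x (delta_mx ord0 i)) /\
              Ck k' (partial i phi)
  else True.

Definition smooth phi := forall k, Ck k phi.

Definition supp phi : set T := closure [set x | phi x != 0].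

Definition test_function Omega phi :=
  [/\ smooth phi, compact (supp phi) & supp phi `<=` Omega].

(* Functions on Omega are represented by functions on the whole space, whose
   values outside Omega are irrelevant: f \_ Omega extends f by zero. *)
Definition Lp Omega (p : \bar R) u := u \_ Omega \in Lfun leb p.

Definition cvg_L2 Omega (v : nat -> T -> R) u :=
  'N[leb]_2%:E[EFin \o ((v k \- u)%R \_ Omega)]%E @[k --> \oo] --> 0%E.

Definition weak_gradient Omega u Du := forall phi i, test_function Omega phi ->
  \int[leb]_(x in Omega) (u x * partial i phi x) =
  - \int[leb]_(x in Omega) (Du x i ord0 * phi x).

Definition H1 Omega u Du :=
  [/\ Lp Omega 2%:E u,
      forall i, Lp Omega 2%:E (fun x => Du x i ord0) &
      weak_gradient Omega u Du].

(* u belongs to the closure of the test functions in H^1(Omega) and its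
   gradient, which is determined by u up to a null set, is Du. *)
Definition H10 Omega u Du :=
  H1 Omega u Du /\
  exists phi : nat -> T -> R,
    [/\ forall k, test_function Omega (phi k),
        cvg_L2 Omega phi u &
        forall i, cvg_L2 Omega (fun k => partial i (phi k))
                    (fun x => Du x i ord0)].

End sobolev.

Section problem.
Variables (R : realType) (n : nat).
Local Notation T := 'rV[R]_n.+1.
Local Notation leb := (@lebesgue_rV R n).
Implicit Types (Omega : set T) (A : T -> 'M[R]_n.+1) (F : T -> R -> \bar R).
Implicit Types (u phi h : T -> R) (Du Dphi : T -> 'cV[R]_n.+1).

Definition dot (x y : 'cV[R]_n.+1) : R := \sum_i x i ord0 * y i ord0.

Definition bounded_elliptic Omega A :=
  (forall i j, Lp Omega +oo%E (fun x => A x i j)) /\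
  exists2 alpha : R, 0 < alpha &
    \forall x \ae leb, Omega x ->
      forall xi, alpha * dot xi xi <= dot (A x *m xi) xi.

(* Only the values F x s with x in Omega and s >= 0 are relevant. *)
Definition caratheodory_nonlinearity Omega F :=
  [/\ forall x (s : R), Omega x -> 0 <= s -> (0 <= F x s)%E,
      \forall x \ae leb, Omega x -> {within `[0, +oo[, continuous (F x)} &
      forall s : R, 0 <= s -> measurable_fun Omega (F ^~ s)].

Definition admissible_exponent (N : nat) (r : R) :=
  [/\ N = 1%N -> r = 1, N = 2%N -> 1 < r &
      (3 <= N)%N -> r = (2 * N)%:R / (N + 2)%:R].

Definition singular_growth Omega F :=
  exists (gamma r : R) h,
    [/\ 0 < gamma <= 1, admissible_exponent n.+1 r, Lp Omega r%:E h,
        \forall x \ae leb, Omega x -> 0 <= h x &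
        \forall x \ae leb, Omega x -> forall s : R, 0 < s ->
          (0 <= F x s <= (h x * (1 / s `^ gamma + 1))%:E)%E].

Definition almost_nonincreasing Omega F (lambda : R) :=
  \forall x \ae leb, Omega x -> forall s t : R, 0 <= t <= s ->
    (F x s - (lambda * s)%:E <= F x t - (lambda * t)%:E)%E.

Definition dirichlet_form Omega A Du Dphi : R :=
  \int[leb]_(x in Omega) dot (A x *m Du x) (Dphi x).

Definition sym_part A : T -> 'M[R]_n.+1 :=
  fun x => 2^-1 *: (A x + (A x)^T).

(* mu is an eigenvalue of - div B D in H^1_0(Omega) *)
Definition dirichlet_eigenvalue Omega B (mu : R) :=
  exists e De,
    [/\ H10 Omega e De, ~ (e = cst 0 %[ae leb in Omega]) &
        forall phi Dphi, H10 Omega phi Dphi ->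
          dirichlet_form Omega B De Dphi =
          mu * \int[leb]_(x in Omega) (e x * phi x)].

Definition first_dirichlet_eigenvalue Omega B (mu : R) :=
  dirichlet_eigenvalue Omega B mu /\
  forall nu, dirichlet_eigenvalue Omega B nu -> mu <= nu.

Definition solution Omega A F u :=
  exists Du,
    [/\ H10 Omega u Du,
        \forall x \ae leb, Omega x -> 0 <= u x &
        forall phi Dphi, H10 Omega phi Dphi ->
          (\forall x \ae leb, Omega x -> 0 <= phi x) ->
          (\int[leb]_(x in Omega) (F x (u x) * (phi x)%:E) < +oo)%E /\
          ((dirichlet_form Omega A Du Dphi)%:E =
           \int[leb]_(x in Omega) (F x (u x) * (phi x)%:E))%E].

End problem.

(* Main.v *)
From HB Require Import structures.
Require Import Defs.
From mathcomp Require Import all_boot all_order all_algebra.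
From mathcomp Require Import all_classical all_reals all_analysis.
From mathcomp Require Import measurable_realfun ess_sup_inf ring lra.

Set Implicit Arguments.
Unset Strict Implicit.
Unset Printing Implicit Defensive.

Import Order.TTheory GRing.Theory Num.Theory.
Import numFieldNormedType.Exports.

Local Open Scope classical_set_scope.
Local Open Scope ring_scope.

(** Write z = u - v.  As u and v are nonnegative elements of H^1_0, both are
    admissible test functions in the equations of u and of v, and the four
    energy identities so obtained combine into
      int A Dz . Dz = int (F(x,u) - F(x,v)) (u - v) <= lambda int z^2.
    Because F may be infinite, the inequality is used in the subtraction-free
    form F(x,u) u + F(x,v) v <= F(x,u) v + F(x,v) u + lambda (u - v)^2, which
    holds pointwise in [0,+oo] ([almost_nonincreasing_mul_le]); it may be
    integrated because x |-> F(x,u(x)) is measurable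
    ([caratheodory_measurable_comp]).  The quadratic form only sees the
    symmetric part of A, so the inequality
      lambda1 int z^2 <= int A^s Dz . Dz   ([rayleigh_first_eigenvalue])
    gives (lambda1 - lambda) int z^2 <= 0, hence z = 0 almost everywhere.

    Here lambda1 is the smallest eigenvalue, so the Rayleigh principle amounts
    to the attainment of the infimum of the Rayleigh quotient.  The attainment
    is proved for abstract forms ([rayleigh_quotient_eigenvector]): along a
    minimizing sequence which is Cauchy for the L^2 form, the parallelogram
    identity makes the sequence Cauchy for the energy form as well.  What is
    needed of H^1_0 is completeness ([H10_complete], which rests on the
    Riesz-Fischer theorem [L2_complete]) and compactness in L^2
    ([H10_precompact]).

    By density, compactness is only needed for C^1 functions of uniformly
    bounded support ([C1c_precompact]), where it follows from Kolmogorov's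
    argument.  The estimate ||f(. + y) - f|| <= C |y| ||Df||
    ([translate_le]) uses no Fubini theorem: by invariance under translations,
    the increment along a segment is at most m times the increment along its
    m-th part, and one lets m tend to infinity.  Tonelli's theorem and Jensen's
    inequality then show that the averages of f over cubes of side e are close
    to f in L^2 ([ip_cube_avg_le]); the averages are equi-Lipschitz, so they are
    controlled by their values on a finite net, and these values converge along
    an ultrafilter. *)

(** * Positive semidefinite forms and the Rayleigh quotient *)

Section psd_form.
Variables (R : realType) (V : lmodType R) (H : set V).

(** A set [H] of vectors closed under linear combinations. *)
Definition subspace := H 0 /\ forall a x y, H x -> H y -> H (a *: x + y).

(** [b] is a symmetric, positive semidefinite bilinear form on [H]; nothing is
    required of [b] outside [H]. *)
Definition psd_form (b : V -> V -> R) :=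
  [/\ forall a x y z, H x -> H y -> H z -> b (a *: x + y) z = a * b x z + b y z,
      forall x y, H x -> H y -> b x y = b y x &
      forall x, H x -> 0 <= b x x].

Hypothesis sH : subspace.

Lemma subspaceD x y : H x -> H y -> H (x + y).
Proof. by move=> Hx Hy; rewrite -[x]scale1r; exact: sH.2. Qed.

Lemma subspaceZ a x : H x -> H (a *: x).
Proof. by move=> Hx; rewrite -[_ *: _]addr0; apply: sH.2 => //; exact: sH.1. Qed.

Lemma subspaceB x y : H x -> H y -> H (x - y).
Proof. by move=> Hx Hy; rewrite addrC -scaleN1r; exact: sH.2. Qed.

Variable b : V -> V -> R.
Hypothesis pb : psd_form b.

Lemma psd_formZD a x y : H x -> H y ->
  b (a *: x + y) (a *: x + y) = a ^+ 2 * b x x + 2 * a * b x y + b y y.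
Proof.
case: pb => lin sym _ Hx Hy; have Hz := sH.2 a x y Hx Hy.
rewrite lin// (sym x)// (sym y)// !lin// (sym y x)//; ring.
Qed.

Lemma psd_form_parallelogram x y : H x -> H y ->
  b (x - y) (x - y) + b (x + y) (x + y) = 2 * b x x + 2 * b y y.
Proof.
move=> Hx Hy; have := psd_formZD 1 Hx Hy; rewrite !scale1r => ->.
have := psd_formZD (-1) Hy Hx; rewrite scaleN1r addrC => ->.
by case: pb => _ sym _; rewrite (sym y x)//; ring.
Qed.

Lemma psd_form_leD x y : H x -> H y ->
  b (x + y) (x + y) <= 2 * b x x + 2 * b y y.
Proof.
move=> Hx Hy; rewrite -psd_form_parallelogram// lerDr.
by case: pb => _ _; apply; exact: subspaceB.
Qed.

Lemma psd_form_leB x y : H x -> H y ->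
  b (x - y) (x - y) <= 2 * b x x + 2 * b y y.
Proof.
move=> Hx Hy; rewrite -psd_form_parallelogram// lerDl.
by case: pb => _ _; apply; exact: subspaceD.
Qed.

(** A vector of zero energy lies in the kernel of the form. *)
Lemma psd_form_kernel x y : H x -> H y -> b x x = 0 -> b x y = 0.
Proof.
move=> Hx Hy x0; have ge0 a : 0 <= 2 * a * b x y + b y y.
  have := psd_formZD a Hx Hy; rewrite x0 mulr0 add0r => <-.
  by case: pb => _ _; apply; exact: sH.2.
(* Otherwise the function that ge0 bounds below is affine and takes the value -1 here. *)
apply/eqP; apply: contraPT (ge0 (- (b y y + 1) / (2 * b x y))) => xy0.
rewrite [X in _ <= X](_ : _ = -1); last by field.
by apply/negP; rewrite -ltNge ltrN10.
Qed.

Lemma psd_formZ a x : H x -> b (a *: x) (a *: x) = a ^+ 2 * b x x.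
Proof.
case: pb => lin sym _ Hx.
have H0 : H 0 by case: sH.
have b0 y : H y -> b 0 y = 0.
  by move=> Hy; have := lin 1 0 0 y H0 H0 Hy; rewrite scaler0 addr0; lra.
by rewrite -[_ *: _]addr0 psd_formZD// (sym x)// b0// b0//; ring.
Qed.

(** Cauchy-Schwarz in its arithmetic-mean form, which avoids square roots. *)
Lemma psd_form_leAM x y (t : R) : 0 < t -> H x -> H y ->
  2 * `|b x y| <= t * b x x + t^-1 * b y y.
Proof.
move=> t0 Hx Hy.
have ge0 z : H z -> 0 <= b z z by case: pb => _ _; exact.
have P := ge0 _ (sH.2 t x y Hx Hy); have N := ge0 _ (sH.2 (- t) x y Hx Hy).
rewrite psd_formZD// in P; rewrite psd_formZD// sqrrN in N.
have tV : 0 < t^-1 by rewrite invr_gt0.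
have {}P := mulr_ge0 (ltW tV) P; have {}N := mulr_ge0 (ltW tV) N.
have E1 : t^-1 * (t ^+ 2 * b x x + 2 * t * b x y + b y y) =
    t * b x x + 2 * b x y + t^-1 * b y y by field; rewrite gt_eqF.
have E2 : t^-1 * (t ^+ 2 * b x x + 2 * - t * b x y + b y y) =
    t * b x x - 2 * b x y + t^-1 * b y y by field; rewrite gt_eqF.
rewrite E1 in P; rewrite E2 in N.
by have [h|h] := leP 0 (b x y); rewrite ?(ger0_norm h) ?(ltr0_norm h); lra.
Qed.

Lemma subspace_sum (I : Type) (r : seq I) (a : I -> V) :
  (forall i, H (a i)) -> H (\sum_(i <- r) a i).
Proof.
move=> Ha; elim: r => [|i r IH]; first by rewrite big_nil; case: sH.
by rewrite big_cons; exact: subspaceD.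
Qed.

(** The squared norm of a sum of k vectors is at most k times the sum of the
    squared norms. *)
Lemma psd_form_sum_le (I : Type) (r : seq I) (a : I -> V) :
  (forall i, H (a i)) ->
  b (\sum_(i <- r) a i) (\sum_(i <- r) a i) <=
  (size r)%:R * \sum_(i <- r) b (a i) (a i).
Proof.
move=> Ha; elim: r => [|i [|j r] IH].
- rewrite !big_nil mulr0 -(scale0r 0) psd_formZ ?expr0n/= ?mul0r//.
  by case: sH.
- by rewrite !big_seq1 mul1r.
rewrite big_cons [X in _ <= _ * X]big_cons [size _]/= -natr1; move: IH.
set S := \sum_(_ <- _) a _; set Q := \sum_(_ <- _) b _ _.
have HS : H S by exact: subspace_sum.
set m := (size (j :: r))%:R => SQ.
have m0 : 0 < m by rewrite ltr0n.
have := psd_formZD 1 (Ha i) HS; rewrite scale1r => ->.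
have : 0 <= b (- m^-1 *: S + a i) (- m^-1 *: S + a i).
  by case: pb => _ _; apply; exact: sH.2.
rewrite psd_formZD// => /(mulr_ge0 (ltW m0)).
case: (pb) => _ sym _; rewrite (sym S)//.
rewrite [X in 0 <= X -> _](_ : _ =
    b S S / m - 2 * b (a i) S + m * b (a i) (a i)); last first.
  by field; rewrite gt_eqF.
have : b S S / m <= Q by rewrite ler_pdivrMr// mulrC.
nra.
Qed.

End psd_form.

Section rayleigh.
Variables (R : realType) (V : lmodType R) (H : set V).
Variables (q m : V -> V -> R).
Hypotheses (sH : subspace H) (pq : psd_form H q) (pm : psd_form H m).

Hypothesis compactH : forall (w : nat -> V) (C : R), (forall k, H (w k)) ->
  (forall k, q (w k) (w k) + m (w k) (w k) <= C) ->
  exists2 s : nat -> nat, (forall k, k <= s k)%N &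
    forall e : R, 0 < e -> exists K, forall i j, (K <= i)%N -> (K <= j)%N ->
      m (w (s i) - w (s j)) (w (s i) - w (s j)) <= e.

Hypothesis completeH : forall (w : nat -> V), (forall k, H (w k)) ->
  (forall e : R, 0 < e -> exists K, forall i j, (K <= i)%N -> (K <= j)%N ->
    q (w i - w j) (w i - w j) + m (w i - w j) (w i - w j) <= e) ->
  exists2 z, H z & forall e : R, 0 < e -> exists K, forall k, (K <= k)%N ->
    q (w k - z) (w k - z) + m (w k - z) (w k - z) <= e.

(** If sequences bounded for [q + m] have [m]-Cauchy subsequences, and [q + m] is
    complete, then the infimum [mu] of [q x x / m x x] is attained.  At a
    minimizer the semidefinite form [q - mu m] vanishes, so the minimizer lies
    in its kernel: it is an eigenvector for [mu]. *)
Lemma rayleigh_quotient_eigenvector : (exists2 x, H x & 0 < m x x) ->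
  exists mu e, [/\ H e, 0 < m e e, forall x, H x -> q e x = mu * m e x &
    forall x, H x -> mu * m x x <= q x x].
Proof.
move=> [x0 Hx0 x0_gt0].
have q0 x : H x -> 0 <= q x x by case: pq => _ _; exact.
have m0 x : H x -> 0 <= m x x by case: pm => _ _; exact.
pose S := [set q x x | x in [set x | H x /\ m x x = 1]].
have normalize x : H x -> 0 < m x x -> S (q x x / m x x).
  move=> Hx x_gt0; exists ((Num.sqrt (m x x))^-1 *: x) => /=.
    split; first exact: subspaceZ.
    by rewrite (psd_formZ sH pm)// exprVn sqr_sqrtr ?ltW// mulVf// gt_eqF.
  by rewrite (psd_formZ sH pq)// exprVn sqr_sqrtr ?ltW// mulrC.
have infS : has_inf S.
  split; first by exists (q x0 x0 / m x0 x0); exact: normalize.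
  by exists 0 => _ [x [Hx _] <-]; exact: q0.
pose mu := inf S.
have mu_le x : H x -> mu * m x x <= q x x.
  move=> Hx; have := m0 _ Hx; rewrite le_eqVlt => /predU1P[<-|x_gt0].
    by rewrite mulr0 q0.
  by rewrite -ler_pdivlMr//; apply: ge_inf; [case: infS|exact: normalize].
have mu_ge0 : 0 <= mu.
  by apply: lb_le_inf => [|_ [x [Hx _] <-]]; [case: infS|exact: q0].
have /choice[w wP] : forall k : nat, exists x,
    [/\ H x, m x x = 1 & q x x < mu + k.+1%:R^-1].
  move=> k; have [_ [x [Hx x1] <-] xk] := @inf_adherent _ S _
    (harmonic_gt0 k) infS.
  by exists x.
have Hw k : H (w k) by case: (wP k).
have [|s sk cauchy_m] := @compactH w (mu + 1 + 1) Hw.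
  move=> k; have [_ -> /ltW qk] := wP k; rewrite lerD2r (le_trans qk)//.
  by rewrite lerD2l invf_le1 ?ltr0Sn// ler1n.
pose p x y := q x y - mu * m x y.
have pp : psd_form H p.
  split=> [a x y z Hx Hy Hz|x y Hx Hy|x Hx].
  - case: pq => ql _ _; case: pm => ml _ _.
    by rewrite /p ql// ml//; ring.
  - by case: pq => _ qs _; case: pm => _ ms _; rewrite /p qs// ms.
  - by rewrite subr_ge0 mu_le.
have p_small e : 0 < e -> exists K, forall k, (K <= k)%N ->
    p (w (s k)) (w (s k)) <= e.
  move=> e0; have [K Ke] : exists K : nat, K.+1%:R^-1 < e.
    by have [K _ KP] := near_infty_natSinv_lt (PosNum e0); exists K;
      exact: (KP K (leqnn K)).
  exists K => k Kk; have [_ m1 /ltW qk] := wP (s k).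
  rewrite /p m1 mulr1 lerBlDl (le_trans qk)// lerD2l (le_trans _ (ltW Ke))//.
  by rewrite lef_pV2 ?posrE// ler_nat ltnS (leq_trans Kk).
have [||z Hz zP] := @completeH (w \o s).
- by move=> k; exact: Hw.
- move=> e e0.
  have mu1 : 0 < mu + 1 by lra.
  have d0 : 0 < e / (2 * (mu + 1)) by rewrite divr_gt0// mulr_gt0.
  have [K1 K1P] := cauchy_m _ d0.
  have e80 : 0 < e / 8 by rewrite divr_gt0.
  have [K2 K2P] := p_small _ e80.
  exists (maxn K1 K2) => i j; rewrite !geq_max => /andP[i1 i2] /andP[j1 j2] /=.
  (* q d = p d + mu m d, where d is the difference of two terms; both are small. *)
  have := psd_form_leB sH pp (Hw (s i)) (Hw (s j)).
  move: (K2P _ i2) (K2P _ j2) (K1P _ _ i1 j1).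
  set d := w (s i) - w (s j); set a := m d d.
  rewrite {3}/p -/a => pi pj a_le.
  have := ler_wpM2l (ltW mu1) a_le.
  rewrite [X in _ <= X -> _](_ : _ = e / 2); last by field; rewrite gt_eqF.
  lra.
exists mu, z; split => //.
(* 1 = m (w k) <= 2 m (w k - z) + 2 m z, so m z is at least 1/4. *)
- have h0 : (0 : R) < 4^-1 by rewrite invr_gt0.
  have [K KP] := zP _ h0; have := KP _ (leqnn K).
  have := psd_form_leD sH pm (subspaceB sH (Hw (s K)) Hz) Hz.
  rewrite subrK; have [_ -> _] := wP (s K).
  have := q0 _ (subspaceB sH (Hw (s K)) Hz); rewrite /=; lra.
- have pz : p z z = 0.
    apply/eqP; rewrite eq_le; apply/andP; split; last first.
      by case: pp => _ _; exact.
    apply/ler_addgt0Pl => e e0; rewrite addr0.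
    have e40 : 0 < e / 4 by rewrite divr_gt0.
    have [K1 K1P] := zP _ e40; have [K2 K2P] := p_small _ e40.
    have := K1P _ (leq_maxl K1 K2); have := K2P _ (leq_maxr K1 K2).
    set k := maxn _ _ => /= pk zk.
    have := psd_form_leB sH pp (Hw (s k)) (subspaceB sH (Hw (s k)) Hz).
    rewrite subKr {3}/p.
    have := m0 _ (subspaceB sH (Hw (s k)) Hz).
    have := mulr_ge0 mu_ge0 (m0 _ (subspaceB sH (Hw (s k)) Hz)).
    lra.
  move=> x Hx; have := psd_form_kernel sH pp Hz Hx pz.
  by move/eqP; rewrite subr_eq0 => /eqP.
Qed.

End rayleigh.

(** * Real inner product and completeness of the space L^2 *)

Section L2.
Context d (T : measurableType d) (R : realType).
Variable mu : {measure set T -> \bar R}.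
Implicit Types f g : T -> R.

(** Square-integrable functions: genuine functions, not classes modulo null
    sets. *)
Definition L2 : set (T -> R) := [set f | f \in Lfun mu 2%:E].

(** The L^2 inner product. *)
Definition ip f g : R := \int[mu]_x (f x * g x).

Lemma L2_measurable f : L2 f -> measurable_fun setT f.
Proof. by rewrite /L2/= => /andP[]; rewrite inE. Qed.

Lemma L2_integrable_sqr f : L2 f -> mu.-integrable setT (fun x => (f x ^+ 2)%:E).
Proof. exact: Lfun2_integrable_sqr. Qed.

Lemma L2_integrable_mul f g : L2 f -> L2 g ->
  mu.-integrable setT (fun x => (f x * g x)%:E).
Proof. by move=> lf lg; apply/Lfun1_integrable; exact: Lfun2_mul_Lfun1. Qed.

Lemma Lnorm2E f : ('N[mu]_2%:E[EFin \o f] =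
  (\int[mu]_x (f x ^+ 2)%:E) `^ 2^-1)%E.
Proof.
rewrite unlock; congr (_ `^ _)%E; apply: eq_integral => x _ /=.
by rewrite powR_mulrn// real_normK// num_real.
Qed.

Lemma L2P f : measurable_fun setT f -> (\int[mu]_x (f x ^+ 2)%:E < +oo)%E ->
  L2 f.
Proof.
move=> mf foo; apply/andP; split; rewrite inE//=.
by rewrite /finite_norm Lnorm2E poweR_lty.
Qed.

Lemma L2_subspace : subspace L2.
Proof.
have p1 : (1 <= 2%:E :> \bar R)%E by rewrite lee_fin ler1n.
have [l0 lD] := @Lfun_submod_closed _ _ _ mu _ p1.
split; first exact: l0.
by move=> a f g lf lg; exact: lD.
Qed.

Lemma ipE f : L2 f -> (ip f f)%:E = (\int[mu]_x (f x ^+ 2)%:E)%E.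
Proof.
move=> lf; rewrite /ip /Rintegral fineK; first exact: eq_integral.
by apply: integrable_fin_num => //; exact: L2_integrable_mul.
Qed.

Lemma ip_psd : psd_form L2 ip.
Proof.
split=> [a f g h lf lg lh|f g lf lg|f lf].
- rewrite /ip -RintegralZl//; last exact: L2_integrable_mul.
  rewrite -RintegralD//.
  + by apply: eq_Rintegral => x _; rewrite mulrDl -mulrA.
  + have := integrableZl measurableT a (L2_integrable_mul lf lh).
    by apply: eq_integrable.
  + exact: L2_integrable_mul.
- by apply: eq_Rintegral => x _; rewrite mulrC.
- by apply: Rintegral_ge0 => x _; rewrite -expr2 sqr_ge0.
Qed.

Lemma ip_eq0 f : L2 f -> ip f f = 0 -> \forall x \ae mu, f x = 0.
Proof.
move=> lf ip0; have f0 := ipE lf; rewrite ip0 in f0.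
have mf2 : measurable_fun setT (fun x => (f x ^+ 2)%:E).
  by case/integrableP: (L2_integrable_sqr lf).
have /(ae_eq_integral_abs _ measurableT mf2) h :
    (\int[mu]_x `|(f x ^+ 2)%:E| = 0)%E.
  by rewrite [RHS]f0; apply: eq_integral => x _; rewrite gee0_abs// lee_fin sqr_ge0.
by apply: filterS h => x /(_ Logic.I) [fx0]; apply/eqP; rewrite -sqrf_eq0 fx0.
Qed.

(** Convergence to zero of L^2 norms, in terms of the inner product. *)
Lemma cvg_Lnorm2P (f : nat -> T -> R) : (forall k, L2 (f k)) ->
  'N[mu]_2%:E[EFin \o f k]%E @[k --> \oo] --> 0%E <->
  forall e : R, 0 < e -> exists K, forall k, (K <= k)%N -> ip (f k) (f k) <= e.
Proof.
move=> lf.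
have ip0 k : 0 <= ip (f k) (f k) by case: ip_psd => _ _; exact.
have -> : (fun k => 'N[mu]_2%:E[EFin \o f k]%E) =
    EFin \o (fun k => Num.sqrt (ip (f k) (f k))).
  by apply/funext => k; rewrite Lnorm2E -ipE// /= powR12_sqrt.
split=> [/fine_cvgP[_ /cvgrPdist_le fk] e e0|fe].
  have [|K _ KP] := fk (Num.sqrt e); first by rewrite sqrtr_gt0.
  exists K => k Kk; have := KP k Kk.
  by rewrite /= sub0r normrN ger0_norm ?sqrtr_ge0// ler_sqrt// ltW.
apply/fine_cvgP; split; first by apply: nearW.
apply/cvgrPdist_le => e e0.
have [K KP] := fe (e ^+ 2) (exprn_gt0 _ e0).
exists K => // k /= Kk; rewrite /= sub0r normrN ger0_norm ?sqrtr_ge0//.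
by rewrite -(ger0_norm (ltW e0)) -sqrtr_sqr ler_sqrt ?sqr_ge0//; exact: KP.
Qed.

(** Riesz-Fischer.  A subsequence [g] with fast decreasing increments [D] has
    [sum_j 4^j (D_j x)^2] finite for almost every [x], hence converges almost
    everywhere; Fatou's lemma bounds the distance to the limit. *)
Lemma L2_complete (f : nat -> T -> R) : (forall k, L2 (f k)) ->
  (forall e : R, 0 < e -> exists K, forall i j, (K <= i)%N -> (K <= j)%N ->
    ip (f i \- f j) (f i \- f j) <= e) ->
  exists2 g, L2 g & forall e : R, 0 < e -> exists K, forall k, (K <= k)%N ->
    ip (f k \- g) (f k \- g) <= e.
Proof.
move=> lf cf.
have lB f1 f2 : L2 f1 -> L2 f2 -> L2 (f1 \- f2).
  by move=> l1 l2; exact: (subspaceB L2_subspace l1 l2).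
pose r (j : nat) : R := (8^-1) ^+ j.
have r0 j : 0 < r j by rewrite exprn_gt0// invr_gt0.
have /choice[K KP] := fun j => cf (r j) (r0 j).
(* A nondecreasing sequence of indices above all the K j. *)
pose N j := (\sum_(i < j.+1) K i)%N.
have KN j : (K j <= N j)%N by rewrite /N big_ord_recr/= leq_addl.
have NS j : (N j <= N j.+1)%N by rewrite /N [X in (_ <= X)%N]big_ord_recr/= leq_addr.
pose g j := f (N j).
have mg j : measurable_fun setT (g j) by exact: (L2_measurable (lf _)).
pose D j := g j.+1 \- g j.
have mD j : measurable_fun setT (D j) by exact: measurable_funB.
have ipD j : ip (D j) (D j) <= r j.
  by apply: (KP j); [exact: leq_trans (KN j) (NS j)|exact: KN].
pose S x := (\sum_(j <oo) (4 ^+ j * D j x ^+ 2)%:E)%E.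
have S_ge0 j x : (0 <= (4 ^+ j * D j x ^+ 2)%:E)%E.
  by rewrite lee_fin mulr_ge0// ?sqr_ge0 ?exprn_ge0.
have mS0 j : measurable_fun setT (fun x => (4 ^+ j * D j x ^+ 2)%:E).
  apply/measurable_EFinP; apply: measurable_funM => //.
  exact: measurable_funX.
have mS : measurable_fun setT S.
  by apply: ge0_emeasurable_sum => // k x _ _; exact: S_ge0.
have S_int : mu.-integrable setT S.
  apply/integrableP; split => //.
  under eq_integral => x _ do rewrite gee0_abs ?nneseries_ge0//.
  rewrite integral_nneseries//.
  apply: (@le_lt_trans _ _ (\sum_(j <oo) (2^-1 ^+ j)%:E)%E).
    apply: lee_nneseries => [j _ _|j _].
      by apply: integral_ge0 => x _; exact: S_ge0.
    under eq_integral => x _ do rewrite EFinM.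
    rewrite ge0_integralZl//.
    - rewrite -ipE; last exact: (lB _ _ (lf _) (lf _)).
      rewrite -EFinM lee_fin (le_trans (ler_wpM2l _ (ipD j)))// ?exprn_ge0//.
      by rewrite /r -exprMn; rewrite [X in X ^+ _](_ : _ = 2^-1)//; field.
    - by apply/measurable_EFinP; exact: measurable_funX.
    - by move=> x _; rewrite lee_fin sqr_ge0.
  have := @cvg_geometric_eseries_half R 2 0.
  rewrite (_ : (fun k => _) = (fun k => (2^-1 ^+ k)%:E)).
    by move=> /cvg_lim => ->//; rewrite ltry.
  apply/funext => k; congr EFin.
  by rewrite addn1 expnS natrM invfM mulrA mulfV// mul1r natrX exprVn.
have g_cvg : \forall x \ae mu, cvgn (g ^~ x).
  apply: filterS (integrable_ae measurableT S_int) => x /(_ Logic.I) Sx.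
  have DS j : `|D j x| <= Num.sqrt (fine (S x)) * 2^-1 ^+ j.
    have : ((4 ^+ j * D j x ^+ 2)%:E <= S x)%E.
      apply: le_trans (nneseries_lim_ge j.+1 _) => //.
      rewrite big_mkord big_ord_recr/= leeDr// sume_ge0// => i _; exact: S_ge0.
    rewrite -[X in (_ <= X)%E]fineK// lee_fin => le_S.
    rewrite exprVn ler_pdivlMr ?exprn_gt0// -(ger0_norm (exprn_ge0 j (ler0n _ 2))).
    rewrite -normrM -sqrtr_sqr ler_wsqrtr// exprMn -exprM mulnC exprM mulrC.
    by rewrite [_ ^+ 2](_ : _ = 4)//; ring.
  have : cvgn (series (D ^~ x)).
    apply: normed_cvg; apply: (series_le_cvg _ _ DS) => [j|j|].
    - exact: normr_ge0.
    - by apply: mulr_ge0; [exact: sqrtr_ge0|exact: exprn_ge0].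
    - by apply: is_cvg_geometric_series; rewrite ger0_norm// invf_lt1// ltr1n.
  move=> /cvg_ex[l Dl]; apply/cvg_ex; exists (g 0%N x + l).
  rewrite [X in X @ _ --> _](_ : _ = fun n => g 0%N x + series (D ^~ x) n); last first.
    by apply/funext => n; rewrite (eq_sum_telescope (g ^~ x)).
  by apply: cvgD => //; exact: cvg_cst.
pose h x := fine (limn_esup (fun j => (g j x)%:E)).
have mh : measurable_fun setT h.
  apply: (measurableT_comp (fine_measurable measurableT)).
  by apply: measurable_fun_limn_esup => j; exact/measurable_EFinP.
have g_h : \forall x \ae mu, g ^~ x @ \oo --> h x.
  apply: filterS g_cvg => x gx.
  rewrite /h is_cvg_limn_esupE; last first.
    by apply/cvg_ex; exists (limn (g ^~ x))%:E; apply: cvg_EFin => //; exact: nearW.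
  by rewrite EFin_lim.
have key k j : (N j <= k)%N ->
    (\int[mu]_x ((f k x - h x) ^+ 2)%:E <= (r j)%:E)%E.
  move=> Njk.
  pose F i x := ((f k x - g (i + j)%N x) ^+ 2)%:E.
  have mF i : measurable_fun setT (F i).
    apply/measurable_EFinP; apply: measurable_funX; apply: measurable_funB => //.
    exact: (L2_measurable (lf _)).
  rewrite (ae_eq_integral (fun x => limn_einf (F ^~ x)))//; last 3 first.
  - apply/measurable_EFinP; apply: measurable_funX; apply: measurable_funB => //.
    exact: (L2_measurable (lf _)).
  - rewrite /limn_einf; apply: measurableT_comp => //.
    by apply: measurable_fun_limn_esup => i; exact: measurableT_comp.
  - apply: filterS g_h => x gx _.
    have Fx : F ^~ x @ \oo --> ((f k x - h x) ^+ 2)%:E.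
      apply: cvg_EFin; first exact: nearW.
      have gj : g (i + j)%N x @[i --> \oo] --> h x by rewrite (cvg_shiftn j (g ^~ x)).
      by apply: cvgM; apply: cvgB => //; exact: cvg_cst.
    rewrite is_cvg_limn_einfE; first exact/esym/cvg_lim.
    by apply/cvg_ex; eexists; exact: Fx.
  apply: le_trans (fatou _ _ _ _) _ => //.
    by move=> i x _; rewrite lee_fin sqr_ge0.
  apply: le_trans (limn_einf_sup _) _.
  rewrite limn_esup_lim; apply: lime_le; first exact: is_cvg_esups.
  apply: nearW => m; apply: ge_ereal_sup => _ [i _ <-].
  rewrite -ipE; last exact: (lB _ _ (lf _) (lf _)).
  rewrite lee_fin; apply: KP; first exact: leq_trans Njk.
  apply: leq_trans (KN j) _.
  elim: i => [|i IH]; first by rewrite add0n.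
  by rewrite addSn (leq_trans IH).
have lh : L2 h.
  have -> : h = f (N 0%N) \- (f (N 0%N) \- h) by apply/funext => x /=; rewrite subKr.
  apply: lB => //; apply: L2P.
    by apply: measurable_funB => //; exact: (L2_measurable (lf _)).
  by apply: le_lt_trans (key (N 0%N) 0%N (leqnn _)) _; rewrite ltry.
exists h => // e e0.
have [j rj] : exists j, r j <= e.
  have r1 : `|8^-1 : R| < 1 by rewrite ger0_norm// invf_lt1// ltr1n.
  have /cvgrPdist_le/(_ e e0)[j _ /(_ j (leqnn _))] := cvg_expr r1.
  by rewrite /= sub0r normrN (ger0_norm (ltW (r0 j))) => rj; exists j.
exists (N j) => k Njk; rewrite -lee_fin ipE; last exact: lB.
by apply: le_trans (key _ _ Njk) _; rewrite lee_fin.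
Qed.

End L2.

(** * Multiplication by bounded functions and restriction in L^2 *)

Section L2_more.
Context d (T : measurableType d) (R : realType).
Variable mu : {measure set T -> \bar R}.
Implicit Types f g : T -> R.

Lemma Rintegral_ae_ge0 f : measurable_fun setT f ->
  (\forall x \ae mu, 0 <= f x) -> 0 <= \int[mu]_x f x.
Proof.
move=> mf f0; rewrite /Rintegral.
rewrite (ae_eq_integral (fun x => `|f x|%:E))//.
- by apply: fine_ge0; apply: integral_ge0 => x _; rewrite lee_fin.
- exact/measurable_EFinP.
- by apply/measurable_EFinP; exact: measurableT_comp.
- by apply: filterS f0 => x fx0 _; rewrite ger0_norm.
Qed.

(** When the whole space is null, the essential supremum carries no information,
    and any bound holds almost everywhere. *)
Lemma Lfun_infty_bounded f : f \in Lfun mu +oo%E ->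
  measurable_fun setT f /\ exists2 K, 0 <= K & \forall x \ae mu, `|f x| <= K.
Proof.
rewrite inE => /andP[]; rewrite !inE/= => mf; rewrite /finite_norm unlock.
move=> foo; split=> //; move: foo; case: ifPn => [pos foo|null _]; last first.
  exists 0 => //; exists setT; split=> //.
  by apply/eqP; rewrite eq_le measure_ge0 andbT leNgt.
have sup_ge := ess_sup_ge mu (abse \o (EFin \o f)).
have sup0 : (0 <= ess_sup mu (abse \o (EFin \o f)))%E.
  by apply: ess_sup_gee => //; apply: nearW => x; exact: abse_ge0.
exists (fine (ess_sup mu (abse \o (EFin \o f)))); first exact: fine_ge0.
apply: filterS sup_ge => x; rewrite /= -lee_fin fineK//.
by rewrite ge0_fin_numE.
Qed.

Lemma L2_bounded_mul (b f : T -> R) (K : R) : measurable_fun setT b -> 0 <= K ->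
  (\forall x \ae mu, `|b x| <= K) -> L2 mu f ->
  L2 mu (b \* f) /\ ip mu (b \* f) (b \* f) <= K ^+ 2 * ip mu f f.
Proof.
move=> mb K0 bK lf; have mf := L2_measurable lf.
have mbf : measurable_fun setT (b \* f) by exact: measurable_funM.
have le_int : (\int[mu]_x ((b \* f) x ^+ 2)%:E <= (K ^+ 2 * ip mu f f)%:E)%E.
  rewrite EFinM ipE// -ge0_integralZl//; last 3 first.
  - by apply/measurable_EFinP; exact: measurable_funX.
  - by move=> x _; rewrite lee_fin sqr_ge0.
  - by rewrite lee_fin sqr_ge0.
  apply: ae_ge0_le_integral => //.
  - by move=> x _; rewrite lee_fin sqr_ge0.
  - by apply/measurable_EFinP; exact: measurable_funX.
  - by move=> x _; rewrite -EFinM lee_fin mulr_ge0 ?sqr_ge0.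
  - by apply/measurable_EFinP; apply: measurable_funM => //; exact: measurable_funX.
  apply: filterS bK => x bxK _; rewrite -EFinM lee_fin exprMn ler_wpM2r ?sqr_ge0//.
  by rewrite -[leLHS]real_normK ?num_real// lerXn2r ?nnegrE.
have lbf : L2 mu (b \* f) by apply: L2P => //; rewrite (le_lt_trans le_int)// ltry.
by split=> //; rewrite -lee_fin ipE.
Qed.

Lemma ip_cvgl (f : nat -> T -> R) f0 g : (forall k, L2 mu (f k)) -> L2 mu f0 ->
  L2 mu g ->
  (forall e : R, 0 < e -> exists K, forall k, (K <= k)%N ->
    ip mu (f k \- f0) (f k \- f0) <= e) ->
  forall e : R, 0 < e -> exists K, forall k, (K <= k)%N ->
    `|ip mu (f k) g - ip mu f0 g| <= e.
Proof.
move=> lf lf0 lg cf e e0; have [lin sym ge0] := ip_psd mu.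
pose G := ip mu g g + 1.
have gg := ge0 _ lg.
have G0 : 0 < G by rewrite ltr_wpDl.
(* With this weight both terms of the arithmetic mean are at most e. *)
pose t := G / e; have t0 : 0 < t by rewrite divr_gt0.
have [K KP] := cf (e / t) (divr_gt0 e0 t0).
exists K => k Kk.
have ld : L2 mu (f k \- f0) := subspaceB (L2_subspace mu) (lf k) lf0.
have -> : ip mu (f k) g - ip mu f0 g = ip mu (f k \- f0) g.
  have := lin (-1) f0 (f k) g lf0 (lf k) lg.
  rewrite (_ : -1 *: f0 + f k = f k \- f0).
    by move=> ->; rewrite mulN1r addrC.
  by apply/funext => x /=; rewrite scaleN1r addrC.
have := psd_form_leAM (L2_subspace mu) (ip_psd mu) t0 ld lg.
have : t * ip mu (f k \- f0) (f k \- f0) <= e.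
  by rewrite mulrC -ler_pdivlMr//; exact: KP.
have : t^-1 * ip mu g g <= e.
  rewrite /t invf_div mulrAC ler_pdivrMr// ler_wpM2l ?(ltW e0)//.
  by rewrite lerDl.
set a := ip _ (_ \- _) _; set b1 := ip _ _ g; set b2 := ip _ _ _; lra.
Qed.

Lemma ip_restrict_le (D : set T) f : measurable D -> L2 mu f ->
  L2 mu (f \_ D) /\ ip mu (f \_ D) (f \_ D) <= ip mu f f.
Proof.
move=> mD lf.
have -> : f \_ D = \1_D \* f.
  apply/funext => x; rewrite /patch /= indicE.
  by case: ifPn => _; rewrite ?mul1r ?mul0r.
have mI : measurable_fun setT (\1_D : T -> R) by exact: measurable_indic.
have I1 : \forall x \ae mu, `|(\1_D : T -> R) x| <= 1.
  by apply: nearW => x; rewrite indicE; case: (x \in D); rewrite ?normr1 ?normr0.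
have [lI] := L2_bounded_mul mI ler01 I1 lf.
by rewrite expr1n mul1r.
Qed.

End L2_more.

(** * Lebesgue measure on R^N: boxes, open sets, translations *)

Section lebesgue_rV_theory.
Variables (R : realType) (n : nat).
Local Notation T := 'rV[R]_n.+1.
Local Notation leb := (@lebesgue_rV R n).

(** The open half-space of the points whose [i]-th coordinate is below [c]. *)
Definition half_space (i : 'I_n.+1) (c : R) : set T := [set x | x ord0 i < c].

(** The part of the box [b] below the hyperplane [x_i = c]; [box_above] is the
    part above it. *)
Definition box_below (i : 'I_n.+1) (c : R) (b : T * T) : T * T :=
  (b.1, \row_j if j == i then Num.min (b.2 ord0 j) c else b.2 ord0 j).

Definition box_above (i : 'I_n.+1) (c : R) (b : T * T) : T * T :=
  (\row_j (if j == i then Num.max (b.1 ord0 j) c else b.1 ord0 j), b.2).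

Lemma box_belowE i c b : box (box_below i c b) = box b `&` half_space i c.
Proof.
apply/seteqP; split=> [x /= xb|x [/= xb xc] j].
  split=> [j|].
    have := xb j; rewrite mxE; case: ifPn => // _ /andP[->/=].
    by rewrite lt_min => /andP[].
  by have := xb i; rewrite mxE eqxx lt_min => /andP[_ /andP[]].
have /andP[-> xj] := xb j; rewrite mxE; case: ifPn => // /eqP ->.
by rewrite lt_min xc andbT; have /andP[] := xb i.
Qed.

Lemma box_aboveE i c b : box (box_above i c b) = box b `&` ~` half_space i c.
Proof.
apply/seteqP; split=> [x /= xb|x [/= xb xc] j].
  split=> [j|].
    have := xb j; rewrite mxE; case: ifPn => // _ /andP[].
    by rewrite ge_max => /andP[-> _ ->].
  have := xb i; rewrite mxE eqxx ge_max => /andP[/andP[_ +] _].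
  by rewrite /half_space/= ltNge => ->.
have /andP[xj ->] := xb j; rewrite mxE andbT; case: ifPn => // /eqP ji.
rewrite ge_max xj/=; move: xc; rewrite /half_space/= ji.
by move=> /negP; rewrite -leNgt.
Qed.

Lemma box_volume_split i c b :
  (box_volume (box_below i c b) + box_volume (box_above i c b) =
   box_volume b)%E.
Proof.
rewrite /box_volume -EFinD; congr EFin.
rewrite (bigD1 i)//= [X in _ + X](bigD1 i)//= [RHS](bigD1 i)//=.
rewrite !mxE eqxx.
under eq_bigr => j ji do rewrite mxE (negbTE ji).
under [X in _ + _ * X]eq_bigr => j ji do rewrite mxE (negbTE ji).
rewrite -mulrDl; congr (_ * _).
set a := b.1 _ _; set d := b.2 _ _.
rewrite /Num.max /Num.min; case: (ltP d c) => ?; case: (ltP a c) => ?;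
  by do ! case: ltP => ?; lra.
Qed.

(** A hyperplane splits each box of a cover into two boxes with the same total
    volume, so half-spaces satisfy Caratheodory's criterion. *)
Lemma half_space_measurable i c : measurable (half_space i c).
Proof.
apply: le_caratheodory_measurable => X.
apply: le_ereal_inf_tmp => _ [I XI <-].
under eq_eseriesr => k _ do rewrite -(box_volume_split i c).
rewrite nneseriesD; last 2 first.
  by move=> k _ _; exact: box_volume_ge0.
  by move=> k _ _; exact: box_volume_ge0.
apply: leeD; apply: ereal_inf_lbound.
  exists (fun k => box_below i c (I k)) => // x [/XI[k _ xk] xc].
  by exists k => //; rewrite box_belowE.
exists (fun k => box_above i c (I k)) => // x [/XI[k _ xk] xc].
by exists k => //; rewrite box_aboveE.
Qed.

Lemma box_measurable b : measurable (box b : set T).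
Proof.
rewrite (_ : box b = \big[setI/setT]_(i < n.+1)
    (~` half_space i (b.1 ord0 i) `&` half_space i (b.2 ord0 i))).
  apply: bigsetI_measurable => i _; apply: measurableI.
    exact/measurableC/half_space_measurable.
  exact: half_space_measurable.
apply/seteqP; split=> [x xb|x].
  apply: (@big_ind _ (fun A : set T => A x)) => // i _.
  have /andP[xi1 xi2] := xb i; split => //.
  by rewrite /half_space/=; apply/negP; rewrite -leNgt.
move=> + i; rewrite (bigD1 i)//= /half_space => -[[/= /negP + ->] _].
by rewrite -leNgt => ->.
Qed.

Lemma le_lebesgue_box b : (leb (box b) <= box_volume b)%E.
Proof.
apply: ereal_inf_lbound; exists (fun k => if k == 0%N then b else (0, 0)).
  by move=> x xb; exists 0%N.
rewrite (nneseries_split 0 1)//; last first.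
  by move=> k _; exact: box_volume_ge0.
rewrite big_nat1 eseries0 ?adde0// => -[|k]//= _ _.
rewrite /box_volume big_ord_recl/= !mxE subrr maxxx.
by rewrite mul0r.
Qed.

Lemma lebesgue_box_lty b : (leb (box b) < +oo)%E.
Proof. by rewrite (le_lt_trans (le_lebesgue_box b))// ltry. Qed.

Lemma ball_rVP (x y : T) (e : R) : 0 < e ->
  ball x e y <-> forall i, `|x ord0 i - y ord0 i| < e.
Proof.
move=> e0; split=> [[_ xy] i|xy]; first exact: xy.
by split=> // i j; rewrite (ord1 i); exact: xy.
Qed.

(** The box with rational corners [q.1] and [q.2].  There are countably many of
    them and they form a base of the topology ([rat_box_nbhs]). *)
Definition rat_box (q : 'rV[rat]_n.+1 * 'rV[rat]_n.+1) : set T :=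
  box (map_mx ratr q.1, map_mx ratr q.2).

Lemma rat_box_measurable q : measurable (rat_box q).
Proof. exact: box_measurable. Qed.

Lemma rat_box_nbhs (x : T) (U : set T) : nbhs x U ->
  exists2 q, rat_box q x & rat_box q `<=` U.
Proof.
move=> /nbhs_ballP[e /= e0 xeU].
have xl i : x ord0 i - e < x ord0 i by rewrite ltrBlDr ltrDl.
have xr i : x ord0 i < x ord0 i + e by rewrite ltrDl.
have /choice[a aP] : forall i, exists q, ratr q \in `]x ord0 i - e, x ord0 i[.
  by move=> i; exact: rat_in_itvoo.
have /choice[b bP] : forall i, exists q, ratr q \in `]x ord0 i, x ord0 i + e[.
  by move=> i; exact: rat_in_itvoo.
exists (\row_i a i, \row_i b i).
  move=> i /=; rewrite !mxE.
  have := aP i; rewrite in_itv/= => /andP[_ /ltW ->].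
  by have := bP i; rewrite in_itv/= => /andP[].
move=> y /= yab; apply/xeU/ball_rVP => // i.
have := yab i; rewrite /= !mxE.
have := aP i; rewrite in_itv/= => /andP[? ?].
have := bP i; rewrite in_itv/= => /andP[? ?].
by move=> /andP[? ?]; rewrite ltr_norml; apply/andP; split; lra.
Qed.

Lemma open_measurable_rV (U : set T) : open U -> measurable U.
Proof.
move=> oU.
rewrite (_ : U = \bigcup_q (if `[< rat_box q `<=` U >] then rat_box q else set0)).
  apply: countable_bigcupT_measurable => // q.
  by case: ifPn => // _; exact: rat_box_measurable.
apply/seteqP; split=> [x Ux|x [q _]]; last by case: asboolP => // qU /qU.
have [q qx qU] := rat_box_nbhs (open_nbhs_nbhs (conj oU Ux)).
by exists q => //; case: asboolP.
Qed.

Lemma continuous_measurable_rV (f : T -> R) : continuous f ->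
  measurable_fun setT f.
Proof.
move=> /continuousP cf.
apply: (measurability _ (RGenOpens.measurableE R)) => //.
move=> _ [_ [a [b ->] <-]]; rewrite setTI; apply: open_measurable_rV.
exact/cf/interval_open.
Qed.

Lemma add_open_measurable (U : set T) : open U ->
  measurable [set z : T * T | U (z.1 + z.2)].
Proof.
move=> oU.
rewrite (_ : [set _ | _] = \bigcup_p
    (if `[< forall x y, rat_box p.1 x -> rat_box p.2 y -> U (x + y) >]
     then rat_box p.1 `*` rat_box p.2 else set0)).
  apply: countable_bigcupT_measurable => // q.
  by case: ifPn => // _; apply: measurableX; exact: rat_box_measurable.
apply/seteqP; split=> [[x y]/= Uxy|z [p _]]; last first.
  by case: asboolP => // pU [? ?]; exact: pU.
have : nbhs (x, y) [set z : T * T | U (z.1 + z.2)].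
  have := @add_continuous T (x, y); apply.
  exact: (open_nbhs_nbhs (conj oU Uxy)).
move=> -[[V W] /= [/rat_box_nbhs[p px pV] /rat_box_nbhs[q qy qW]] VWU].
exists (p, q) => //=; case: asboolP => // -[] x' y' px' qy'.
by apply: (VWU (x', y')); split; [exact: pV|exact: qW].
Qed.

(** [(x, y) |-> f (x + y)] is measurable for the product of the two Lebesgue
    sigma-algebras. *)
Lemma continuous_add_measurable (f : T -> R) : continuous f ->
  measurable_fun setT (fun z : T * T => f (z.1 + z.2)).
Proof.
move=> /continuousP cf.
apply: (measurability _ (RGenOpens.measurableE R)) => //.
move=> _ [_ [a [b ->] <-]]; rewrite setTI.
have oU : open (f @^-1` `]a, b[%classic) by exact/cf/interval_open.
exact: (add_open_measurable oU).
Qed.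

Lemma lebesgue_translate (a : T) (A : set T) :
  leb ((fun x => x + a) @^-1` A) = leb A.
Proof.
suff le B b : (leb ((fun x => (x + b)%R) @^-1` B) <= leb B)%E.
  apply/eqP; rewrite eq_le le/=.
  rewrite [X in (leb X <= _)%E](_ : A = (fun x => x - a)
      @^-1` ((fun x => x + a) @^-1` A)) ?le//.
  by apply/seteqP; split=> x /=; rewrite subrK.
apply: le_ereal_inf_tmp => _ [I BI <-].
apply: ereal_inf_lbound; exists (fun k => ((I k).1 - b, (I k).2 - b)).
  move=> x /BI[k _ xk]; exists k => // i; have := xk i; rewrite !mxE.
  by rewrite lerBlDr ltrBrDr.
apply: eq_eseriesr => k _; congr EFin; apply: eq_bigr => i _.
by rewrite !mxE opprB addrA subrK.
Qed.

Lemma translate_measurable (a : T) (A : set T) : measurable A ->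
  measurable ((fun x => x + a) @^-1` A).
Proof.
move=> mA; apply: le_caratheodory_measurable => X.
set t := fun x => x + a; pose Y := (fun x => x - a) @^-1` X.
have XY : X = t @^-1` Y by apply/seteqP; split=> x; rewrite /t/= /Y/= addrK.
have tr B : lebesgue_outer (t @^-1` B) = lebesgue_outer B.
  exact: lebesgue_translate.
have e : lebesgue_outer Y =
  (lebesgue_outer (Y `&` A) + lebesgue_outer (Y `&` ~` A))%E := mA Y.
suff <- : lebesgue_outer X = (lebesgue_outer (X `&` t @^-1` A) +
  lebesgue_outer (X `&` ~` (t @^-1` A)))%E by exact: lexx.
by rewrite {1}XY tr e -(tr (_ `&` A)) -(tr (_ `&` ~` A)) [in RHS]XY.
Qed.

Lemma translate_measurable_fun (a : T) : measurable_fun setT (fun x : T => x + a).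
Proof. by move=> _ A mA; rewrite setTI; exact: translate_measurable. Qed.

Lemma ge0_integral_translate (a : T) (f : T -> \bar R) :
  measurable_fun setT f -> (forall x, (0 <= f x)%E) ->
  (\int[leb]_x f (x + a)%R = \int[leb]_x f x)%E.
Proof.
move=> mf f0.
have mt := translate_measurable_fun a.
rewrite -[LHS](ge0_integral_pushforward mt leb measurableT mf)//.
apply: eq_measure_integral => A mA _; exact: lebesgue_translate.
Qed.

Lemma norm_coord_le (x : T) i : `|x ord0 i| <= `|x|.
Proof.
rewrite /Num.norm/= mx_normrE.
exact: (le_bigmax_cond 0 (fun ij => `|x ij.1 ij.2|) (isT : xpredT (ord0, i))).
Qed.

Lemma bounded_sub_box (A : set T) : bounded_set A ->
  exists M : R, A `<=` box (const_mx (- M), const_mx M).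
Proof.
move=> /pinfty_ex_gt0[M M0 AM]; exists (M + 1) => x /AM xM i; rewrite !mxE.
have := le_trans (norm_coord_le x i) xM.
by rewrite ler_norml => /andP[? ?]; apply/andP; split; lra.
Qed.

Lemma lebesgue_bounded_lty (A : set T) : bounded_set A -> (leb A < +oo)%E.
Proof.
move=> /bounded_sub_box[M AM].
apply: le_lt_trans (lebesgue_box_lty (const_mx (- M), const_mx M)).
exact: le_lebesgue_outer.
Qed.

Lemma lebesgue_rV_sigma_finite : sigma_finite setT leb.
Proof.
exists (fun k => box (const_mx (- k%:R), const_mx k%:R)).
  apply/seteqP; split => // x _.
  have [] := @bounded_sub_box [set x].
    by exists `|x|; split=> [|r xr y ->]; [exact: normr_real|exact: ltW].
  move=> M /(_ x erefl) xM.
  exists (Num.bound `|M|) => // i; have := xM i; rewrite !mxE.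
  have := archi_boundP (normr_ge0 M); have := ler_norm M.
  by move=> ? ? /andP[? ?]; apply/andP; split; lra.
move=> k; split; first exact: box_measurable.
exact: lebesgue_box_lty.
Qed.

Lemma lebesgue_rV_complete : measure_is_complete leb.
Proof. exact: measure_is_complete_caratheodory. Qed.

(** If some cube is null then the whole space is, being covered by countably many
    translates of it.  This dichotomy replaces the exact volume of a cube. *)
Lemma lebesgue_box0_null (e : R) : 0 < e ->
  leb (box (0, const_mx e)) = 0 -> leb setT = 0.
Proof.
move=> e0 null.
pose F k := oapp (fun q : 'rV[rat]_n.+1 =>
  (fun x : T => x + - map_mx ratr q) @^-1` box (0, const_mx e)) set0 (unpickle k).
have [k|N [mN N0 subN]] := @negligible_bigcup _ _ _ leb F.
  rewrite /F; case: unpickle => [q|]/=; last exact: negligible_set0.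
  exists ((fun x : T => x + - map_mx ratr q) @^-1` box (0, const_mx e)).
  split=> //; last by rewrite lebesgue_translate.
  exact/translate_measurable/box_measurable.
apply/eqP; rewrite eq_le measure_ge0 andbT -N0; apply: le_lebesgue_outer.
apply: subset_trans subN => x _.
have /choice[a aP] : forall i, exists q, ratr q \in `]x ord0 i - e, x ord0 i[.
  by move=> i; apply: rat_in_itvoo; rewrite ltrBlDr ltrDl.
exists (pickle (\row_i a i)) => //; rewrite /F pickleK/= => i.
rewrite /= !mxE; have := aP i; rewrite in_itv/= => /andP[? ?].
by apply/andP; split; lra.
Qed.

End lebesgue_rV_theory.

HB.instance Definition _ (R : realType) (n : nat) :=
  Measure_isSigmaFinite.Build _ 'rV[R]_n.+1 R (@lebesgue_rV R n)
    (@lebesgue_rV_sigma_finite R n).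

(** * Translation estimate for C^1 functions of bounded support *)

Section continuous_compact_support.
Variables (R : realType) (n : nat).
Local Notation T := 'rV[R]_n.+1.
Local Notation leb := (@lebesgue_rV R n).
Implicit Types (f phi psi : T -> R).

(** The closed ball of radius [M] for the sup norm, centered at the origin. *)
Definition cball (M : R) : set T := [set x | `|x| <= M].

Lemma cball_closed M : closed (cball M).
Proof.
rewrite (_ : cball M = (fun x : T => `|x|) @^-1` [set y : R | y <= M])//.
apply: preimage_closed; first by move=> x _; exact: norm_continuous.
exact: closed_le.
Qed.

Lemma cball_bounded M : bounded_set (cball M).
Proof.
exists `|M|; split=> [|r Mr x]; first exact: num_real.
by move=> /le_trans; apply; rewrite (le_trans (ler_norm M))// ltW.
Qed.

Lemma cball_measurable M : measurable (cball M).
Proof.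
rewrite -[cball M]setCK; apply/measurableC/open_measurable_rV.
exact/closed_openC/cball_closed.
Qed.

Lemma cball_lty M : (leb (cball M) < +oo)%E.
Proof. exact/lebesgue_bounded_lty/cball_bounded. Qed.

Lemma continuous_bounded_cball f M : continuous f ->
  exists2 B, 0 <= B & forall x, `|x| <= M -> `|f x| <= B.
Proof.
move=> cf.
have : compact (f @` cball M).
  apply: continuous_compact; first exact: continuous_subspaceT.
  apply: bounded_closed_compact; first exact: cball_bounded.
  exact: cball_closed.
move=> /compact_bounded/pinfty_ex_gt0[B B0 fB]; exists B; first exact: ltW.
by move=> x xM; apply: fB; exists x.
Qed.

(** [f] is continuous and vanishes outside the ball of radius [M]. *)
Definition Cc M f := continuous f /\ forall x, M < `|x| -> f x = 0.

Lemma CcB M f g : Cc M f -> Cc M g -> Cc M (f \- g).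
Proof.
move=> [cf f0] [cg g0]; split=> [x|x xM /=]; last by rewrite f0// g0// subrr.
by apply: continuousB; [exact: cf|exact: cg].
Qed.

Lemma Cc_bounded M f : Cc M f -> exists2 B, 0 <= B & forall x, `|f x| <= B.
Proof.
move=> [cf f0]; have [B B0 fB] := continuous_bounded_cball M cf.
exists B => // x; have [/fB//|xM] := leP `|x| M.
by rewrite f0// normr0.
Qed.

Lemma cball_indic_integrable (M B : R) :
  leb.-integrable setT (fun x => (B * \1_(cball M) x)%:E).
Proof.
have /(integrableZl measurableT B) : leb.-integrable setT
    (EFin \o \1_(cball M)); last by [].
apply/integrableP; split.
  by apply/measurable_EFinP/measurable_indic; exact: cball_measurable.
under eq_integral => x _ do rewrite gee0_abs ?lee_fin//.
rewrite integral_indic ?setIT//; first exact: cball_lty.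
exact: cball_measurable.
Qed.

Lemma bounded_supp_integrable M f : measurable_fun setT f ->
  (exists B, forall x, `|f x| <= B) -> (forall x, M < `|x| -> f x = 0) ->
  leb.-integrable setT (EFin \o f).
Proof.
move=> mf [B fB] f0.
have intB := @cball_indic_integrable M B.
apply: (le_integrable measurableT _ _ intB); first exact/measurable_EFinP.
move=> x _ /=; rewrite lee_fin indicE; have [xM|xM] := leP `|x| M.
  by rewrite mem_set// mulr1 (le_trans (fB x))// ler_norm.
by rewrite f0// normr0.
Qed.

Lemma Cc_integrable M f : Cc M f -> leb.-integrable setT (EFin \o f).
Proof.
move=> [cf f0]; apply: (@bounded_supp_integrable M) => //.
  exact: continuous_measurable_rV.
by have [B _ fB] := Cc_bounded (conj cf f0); exists B.
Qed.

Lemma Cc_sqr M f : Cc M f -> Cc M (fun x => f x ^+ 2).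
Proof.
move=> [cf f0]; split=> [x|x xM]; last by rewrite f0// expr0n.
by apply: continuousM; exact: cf.
Qed.

Lemma Cc_L2 M f : Cc M f -> L2 leb f.
Proof.
move=> cf; apply: L2P; first by apply: continuous_measurable_rV; case: cf.
exact/integrable_lty/(Cc_integrable (Cc_sqr cf)).
Qed.

Lemma CcS (M M' : R) f : M <= M' -> Cc M f -> Cc M' f.
Proof. by move=> MM [cf f0]; split=> // x xM; apply/f0/(le_lt_trans MM). Qed.

Lemma Cc_translate M f (a : T) : Cc M f -> Cc (M + `|a|) (fun x => f (x + a)).
Proof.
move=> [cf f0]; split=> [x|x xM].
  apply: (@continuous_comp _ _ _ (fun x => x + a) f); last exact: cf.
  by apply: continuousD; [exact: cvg_id|exact: cst_continuous].
apply: f0; rewrite -(ltrD2r `|a|) (lt_le_trans xM)//.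
by rewrite -[x in leLHS](addrK a) (le_trans (ler_normB _ _)).
Qed.

(** [phi] has continuous first partial derivatives and vanishes, together with
    them, outside the ball of radius [M]. *)
Definition C1c M phi :=
  [/\ Cc M phi, forall i x, derivable phi x (delta_mx ord0 i) &
      forall i, Cc M (partial i phi)].

Lemma C1cB M phi psi : C1c M phi -> C1c M psi ->
  C1c M (phi \- psi) /\
  forall i, partial i (phi \- psi) = partial i phi \- partial i psi.
Proof.
move=> [cphi dphi cdphi] [cpsi dpsi cdpsi].
have dB i : partial i (phi \- psi) = partial i phi \- partial i psi.
  by apply/funext => x; rewrite /partial deriveB.
split; last exact: dB.
split; first exact: CcB.
  by move=> i x; exact: (derivableB (dphi i x) (dpsi i x)).
by move=> i; rewrite dB; exact: CcB.
Qed.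

Lemma integral_translate_sqr M f (a : T) : Cc M f ->
  ip leb (fun x => f (x + a)) (fun x => f (x + a)) = ip leb f f.
Proof.
move=> cf; suff : (ip leb (fun x => f (x + a)) (fun x => f (x + a)))%:E =
  (ip leb f f)%:E by case.
rewrite !ipE; [|exact: (Cc_L2 cf)|exact: (Cc_L2 (Cc_translate a cf))].
have mf2 : measurable_fun setT (fun x => (f x ^+ 2)%:E).
  by apply/measurable_EFinP/continuous_measurable_rV; case: (Cc_sqr cf).
apply: (ge0_integral_translate a mf2) => x.
by rewrite lee_fin sqr_ge0.
Qed.

Lemma is_derive_line phi i x (t : R) :
  (forall y, derivable phi y (delta_mx ord0 i)) ->
  is_derive t (1 : R) (fun s : R => phi (x + s *: delta_mx ord0 i))
    (partial i phi (x + t *: delta_mx ord0 i)).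
Proof.
move=> dphi; have := dphi (x + t *: delta_mx ord0 i).
set e := delta_mx _ _ => dphix.
have eq : (fun h : R => h^-1 *: (((fun s => phi (x + s *: e)) \o shift t) (h *: 1) -
      phi (x + t *: e))) =
    (fun h : R => h^-1 *: ((phi \o shift (x + t *: e)) (h *: e) -
      phi (x + t *: e))).
  apply/funext => h /=; congr (_ *: (phi _ - _)).
  by rewrite scalerDl addrCA [h *: 1]mulr1.
by split; rewrite ?/derivable ?/derive /= eq.
Qed.

Lemma difference_quotient_le phi i (B : R) :
  continuous phi ->
  (forall y, derivable phi y (delta_mx ord0 i)) ->
  forall x (h : R), (forall t, `|t| <= `|h| ->
    `|partial i phi (x + t *: delta_mx ord0 i)| <= B) ->
  `|phi (x + h *: delta_mx ord0 i) - phi x| <= B * `|h|.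
Proof.
move=> cphi dphi x h hB; set e := delta_mx _ _.
pose g (s : R) := phi (x + s *: e).
have cg : continuous g.
  move=> t; apply: (@continuous_comp _ _ _ (fun s : R => x + s *: e) phi).
    apply: cvgD; first exact: cvg_cst.
    by apply: cvgZl; exact: cvg_id.
  exact: cphi.
have g0 : phi x = g 0 by rewrite /g scale0r addr0.
rewrite g0 -/(g h).
have [h0|h0] := leP 0 h.
  have [c|c] := MVT_segment h0 (fun t _ => is_derive_line x t dphi) _.
    exact: continuous_subspaceT.
  rewrite in_itv/= => /andP[c0 ch] ->; rewrite subr0 normrM ler_wpM2r//.
  by apply: hB; rewrite !ger0_norm.
have [c|c] := MVT_segment (ltW h0) (fun t _ => is_derive_line x t dphi) _.
  exact: continuous_subspaceT.
rewrite in_itv/= distrC => /andP[c0 ch] ->; rewrite sub0r normrM normrN ler_wpM2r//.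
by apply: hB; rewrite !ler0_norm// ?lerN2// ltW.
Qed.

Lemma CcZ M f (a : R) : Cc M f -> Cc M (fun x => a * f x).
Proof.
move=> [cf f0]; split=> [x|x xM]; last by rewrite f0// mulr0.
by apply: continuousM; [exact: cst_continuous|exact: cf].
Qed.

Lemma difference_quotient_cvg phi i (s : R) x :
  derivable phi x (delta_mx ord0 i) ->
  (k.+1%:R * (phi (x + (s / k.+1%:R) *: delta_mx ord0 i) - phi x)
    @[k --> \oo] --> s * partial i phi x).
Proof.
move=> dphi; set e := delta_mx _ _.
have [->|s0] := eqVneq s 0.
  rewrite mul0r [X in X @ _ --> _](_ : _ = cst 0); first exact: cvg_cst.
  by apply/funext => k; rewrite mul0r scale0r addr0 subrr mulr0.
pose h k : R := s / k.+1%:R.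
have h0 k : h k != 0 by rewrite mulf_neq0// invr_eq0.
have hcvg : h k @[k --> \oo] --> 0.
  rewrite -[X in _ --> X](mulr0 s); apply: cvgM; first exact: cvg_cst.
  exact: cvg_harmonic.
have /cvgr_dnbhsP/(_ h (conj h0 hcvg)) := dphi.
rewrite -/(derive phi x e) -/(partial i phi x) => dh.
rewrite [X in X @ _ --> _](_ : _ = fun k =>
    s * ((h k)^-1 *: (phi (h k *: e + x) - phi x))); last first.
  apply/funext => k; rewrite [_ *: (_ - _)]/(_ * _) mulrA [_ + x]addrC.
  by congr (_ * _); rewrite /h invf_div mulrCA mulfV// mulr1.
by apply: cvgM => //; exact: cvg_cst.
Qed.

(** Write the increment of [phi] along [s e_i] as a sum of [k + 1] translates of
    the increment [d k] along [s e_i / (k + 1)].  By invariance its squared norm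
    is at most that of the difference quotient [Q k = (k + 1) d k], which tends
    to [s] times the partial derivative by dominated convergence. *)
Lemma translate_direction_le M phi i (s : R) : C1c M phi ->
  ip leb (fun x => phi (x + s *: delta_mx ord0 i) - phi x)
         (fun x => phi (x + s *: delta_mx ord0 i) - phi x) <=
  s ^+ 2 * ip leb (partial i phi) (partial i phi).
Proof.
move=> [cphi dphi cdphi]; set e := delta_mx _ _.
set D := fun x => _ - _.
pose h k : R := s / k.+1%:R.
pose d k x := phi (x + h k *: e) - phi x.
pose Q k x := k.+1%:R * d k x.
(* All increments of length at most |s| vanish outside this ball. *)
pose M' := M + `|s| * `|e|.
have hs k : `|h k| <= `|s|.
  by rewrite /h normrM normfV [`|k.+1%:R|]ger0_norm// ler_pdivrMr// ler_peMr// ler1n.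
have cd k : Cc M' (d k).
  apply: CcB; last first.
    by apply: CcS cphi; rewrite lerDl mulr_ge0.
  apply: CcS (Cc_translate _ cphi).
  by rewrite lerD2l normrZ ler_wpM2r.
have cQ k : Cc M' (Q k) by exact: CcZ.
have key k : ip leb D D <= ip leb (Q k) (Q k).
  have -> : D = \sum_(j < k.+1) (fun x => d k (x + (j%:R * h k) *: e)).
    apply/funext => x; rewrite fct_sumE /D /d.
    rewrite -(big_mkord xpredT (fun j => phi (x + (j%:R * h k) *: e + h k *: e) -
      phi (x + (j%:R * h k) *: e))).
    pose g j := phi (x + (j%:R * h k) *: e).
    rewrite (@telescope_sumr_eq _ _ _ g)//.
      by rewrite /g mul0r scale0r addr0 /h mulrCA mulfV// mulr1.
    by move=> j _; rewrite /g -natr1 mulrDl mul1r scalerDl addrA.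
  apply: le_trans (psd_form_sum_le (L2_subspace leb) (ip_psd leb) _ _) _.
    by move=> j; exact: (Cc_L2 (Cc_translate _ (cd k))).
  under eq_bigr => j _ do rewrite (integral_translate_sqr _ (cd k)).
  have -> : size (index_enum 'I_k.+1) = k.+1 by rewrite -sum1_size sum1_card card_ord.
  rewrite big_const_ord iter_addr_0.
  rewrite -[ip _ _ _ *+ _]mulr_natl mulrA -expr2.
  by rewrite -(psd_formZ (L2_subspace leb) (ip_psd leb) _ (Cc_L2 (cd k))).
have lim : (\int[leb]_x ((Q k x) ^+ 2)%:E)%E @[k --> \oo] -->
    (\int[leb]_x ((s * partial i phi x) ^+ 2)%:E)%E.
  have [B B0 dB] := Cc_bounded (cdphi i).
  apply: (@dominated_cvg _ _ _ leb setT measurableT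
    (fun k x => ((Q k x) ^+ 2)%:E) (fun x => ((s * partial i phi x) ^+ 2)%:E)
    (fun x => ((B * `|s|) ^+ 2 * \1_(cball M') x)%:E)).
  - move=> k; apply/measurable_EFinP/continuous_measurable_rV.
    by case: (Cc_sqr (cQ k)).
  - move=> x _; apply: cvg_EFin; first exact: nearW.
    have := difference_quotient_cvg (dphi i x) (s := s).
    by move=> Qx; apply: cvgM; exact: Qx.
  - by [].
  - exact: cball_indic_integrable.
  - move=> k x _; rewrite gee0_abs ?lee_fin ?sqr_ge0// indicE.
    have [xM|xM] := leP `|x| M'.
      rewrite mem_set// mulr1 -[leLHS]real_normK ?num_real//.
      rewrite lerXn2r ?nnegrE ?mulr_ge0// /Q normrM ger0_norm// mulrC.
      have := difference_quotient_le cphi.1 (dphi i) (fun t _ => dB _).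
      move=> /(_ x (h k)); rewrite -/e -/(d k x) => /ler_wpM2r.
      move=> /(_ k.+1%:R (ler0n _ _)) /le_trans; apply.
      rewrite -mulrA ler_wpM2l// /h normrM normfV [`|k.+1%:R|]ger0_norm//.
      by rewrite mulfVK.
    by case: (cQ k) => _ /(_ _ xM) ->; rewrite expr0n mulr_ge0 ?sqr_ge0.
have c := Cc_L2 (CcZ s (cdphi i)).
have LD : L2 leb D.
  apply: (@Cc_L2 M'); apply: CcB; last by apply: CcS cphi; rewrite lerDl mulr_ge0.
  by apply: CcS (Cc_translate _ cphi); rewrite lerD2l normrZ.
rewrite -(psd_formZ (L2_subspace leb) (ip_psd leb) _ (Cc_L2 (cdphi i))).
rewrite -lee_fin [leRHS](ipE c) -(cvg_lim _ lim)//.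
apply: lime_ge; first by apply/cvg_ex; eexists; exact: lim.
apply: nearW => k; rewrite -ipE; last exact: (Cc_L2 (cQ k)).
by rewrite lee_fin.
Qed.

End continuous_compact_support.

(** * Averages over small cubes *)

Lemma integrable_cst_fin d (T : measurableType d) (R : realType)
    (mu : {measure set T -> \bar R}) (D : set T) (a : R) : measurable D ->
  (mu D < +oo)%E -> mu.-integrable D (EFin \o cst a).
Proof.
move=> mD Doo; apply/integrableP; split; first exact/measurable_EFinP.
rewrite (eq_integral (cst `|a|%:E))// integral_cst//=.
by rewrite lte_mul_pinfty// lee_fin.
Qed.

(** Jensen's inequality for the square function. *)
Lemma sqr_Rintegral_le d (T : measurableType d) (R : realType)
    (mu : {measure set T -> \bar R}) (D : set T) (f : T -> R) : measurable D ->
  (mu D < +oo)%E -> 0 < fine (mu D) -> mu.-integrable D (EFin \o f) ->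
  mu.-integrable D (fun x => (f x ^+ 2)%:E) ->
  (\int[mu]_(x in D) f x) ^+ 2 <= fine (mu D) * \int[mu]_(x in D) (f x ^+ 2).
Proof.
move=> mD Doo c0 intf intf2.
move: c0; set c := fine (mu D) => c0; set I1 := \int[mu]_(x in D) f x.
have intc (a : R) := integrable_cst_fin a mD Doo.
have intZ (a : R) : mu.-integrable D (EFin \o (fun x => a * f x)).
  exact: (integrableZl mD a intf).
have key t : 0 <= \int[mu]_(x in D) (f x ^+ 2) - 2 * t * I1 + t ^+ 2 * c.
  have : 0 <= \int[mu]_(x in D) (f x - t) ^+ 2.
    by apply: Rintegral_ge0 => x _; exact: sqr_ge0.
  rewrite (_ : (fun x => _) = fun x => f x ^+ 2 - 2 * t * f x + t ^+ 2).
    rewrite RintegralD//; first by rewrite RintegralB// RintegralZl// Rintegral_cst.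
    - exact: (integrableB mD intf2 (intZ _)).
    - exact: (intc (t ^+ 2)).
  by apply/funext => x; ring.
have /(mulr_ge0 (ltW c0)) := key (I1 / c); rewrite -subr_ge0.
by congr (is_true (_ <= _)); field; rewrite gt_eqF.
Qed.

Section compactness.
Variables (R : realType) (n : nat).
Local Notation T := 'rV[R]_n.+1.
Local Notation leb := (@lebesgue_rV R n).
Implicit Types (f phi psi : T -> R).

(** The squared L^2 norm of the gradient. *)
Definition dirichlet_energy phi : R :=
  \sum_i ip leb (partial i phi) (partial i phi).

Lemma dirichlet_energy_ge0 phi : 0 <= dirichlet_energy phi.
Proof.
by apply: sumr_ge0 => i _; apply: Rintegral_ge0 => x _; rewrite -expr2 sqr_ge0.
Qed.

(** The increment along [y] is the sum of the increments along the coordinates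
    of [y], each of them a translate of [d i]. *)
Lemma translate_le M phi (y : T) (r : R) : C1c M phi -> `|y| <= r ->
  ip leb (fun x => phi (x + y) - phi x) (fun x => phi (x + y) - phi x) <=
  n.+1%:R * r ^+ 2 * dirichlet_energy phi.
Proof.
move=> cphi yr.
(* P k keeps the first k coordinates of y. *)
pose P k : T := \sum_(j < n.+1 | (j < k)%N) y ord0 j *: delta_mx ord0 j.
pose d (i : 'I_n.+1) x := phi (x + y ord0 i *: delta_mx ord0 i) - phi x.
have PS (i : 'I_n.+1) : P i.+1 = P i + y ord0 i *: delta_mx ord0 i.
  rewrite /P (bigD1 i)//= addrC; congr (_ + _).
  by apply: eq_bigl => j; rewrite ltnS ltn_neqAle andbC.
have cd i : Cc (M + `|y ord0 i *: delta_mx ord0 i : T|) (d i).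
  case: cphi => cphi _ _.
  by apply: CcB; [exact: Cc_translate|apply: CcS cphi; rewrite lerDl].
have -> : (fun x => phi (x + y) - phi x) = \sum_(i < n.+1) (fun x => d i (x + P i)).
  apply/funext => x; rewrite fct_sumE.
  transitivity (\sum_(i < n.+1) (phi (x + P i.+1) - phi (x + P i))).
    rewrite -(big_mkord xpredT (fun i => phi (x + P i.+1) - phi (x + P i))).
    rewrite (telescope_sumr (fun i => phi (x + P i)))//.
    congr (phi (_ + _) - phi _).
      rewrite {1}[y]row_sum_delta /P; apply: eq_bigl => j; by rewrite ltn_ord.
    by rewrite /P big_pred0 ?addr0.
  by apply: eq_bigr => i _; rewrite /d PS addrA.
apply: le_trans (psd_form_sum_le (L2_subspace leb) (ip_psd leb) _ _) _.
  by move=> i; exact: (Cc_L2 (Cc_translate _ (cd i))).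
rewrite (_ : size _ = n.+1); last by rewrite -sum1_size sum1_card card_ord.
rewrite -mulrA ler_wpM2l// mulr_sumr ler_sum// => i _.
rewrite (integral_translate_sqr _ (cd i)).
apply: le_trans (translate_direction_le _ _ cphi) _.
rewrite ler_wpM2r//.
  by apply: Rintegral_ge0 => x _; rewrite -expr2 sqr_ge0.
rewrite -[leLHS]real_normK ?num_real// lerXn2r ?nnegrE//.
  by rewrite (le_trans _ yr).
by rewrite (le_trans (norm_coord_le _ _)).
Qed.

(** The half-open cube of side [e] with lowest corner at the origin. *)
Definition cube (e : R) : set T := box (0, const_mx e).

(** The average of [phi] over the cube of side [e] with lowest corner [x]. *)
Definition cube_avg (e : R) phi (x : T) : R :=
  (fine (leb (cube e)))^-1 * \int[leb]_(y in cube e) phi (y + x).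

Lemma cube_norm e y : 0 <= e -> cube e y -> `|y| <= e.
Proof.
move=> e0 ye; rewrite /Num.norm/= mx_normrE; apply: bigmax_le => // -[i j] _ /=.
by have := ye j; rewrite !mxE (ord1 i) => /andP[? ?]; rewrite ger0_norm// ltW.
Qed.

Lemma cube_measurable e : measurable (cube e).
Proof. exact: box_measurable. Qed.

Lemma cube_fineK e : ((fine (leb (cube e)))%:E = leb (cube e))%E.
Proof. by rewrite fineK// ge0_fin_numE// lebesgue_box_lty. Qed.

Section cube_average.
Variable e : R.
Hypotheses (e_gt0 : 0 < e) (cube_gt0 : 0 < fine (leb (cube e))).
Let Q : set T := cube e.
Let c : R := fine (leb Q).
Let mQ : measurable Q := cube_measurable e.
Let Qoo : (leb Q < +oo)%E := lebesgue_box_lty _.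

Let Cc_integrableQ M f : Cc M f -> leb.-integrable Q (EFin \o f).
Proof. by move=> cf; exact: (integrableS measurableT mQ _ (Cc_integrable cf)). Qed.

Let avg_sqr_le (f : T -> R) : leb.-integrable Q (EFin \o f) ->
  leb.-integrable Q (fun x => (f x ^+ 2)%:E) ->
  (c^-1 * \int[leb]_(y in Q) f y) ^+ 2 <= c^-1 * \int[leb]_(y in Q) (f y ^+ 2).
Proof.
move=> intf intf2; have := sqr_Rintegral_le mQ Qoo cube_gt0 intf intf2.
rewrite exprMn -/c => le_c.
rewrite expr2 -mulrA ler_wpM2l ?invr_ge0 ?(ltW cube_gt0)//.
by rewrite ler_pdivrMl.
Qed.

Let avg_Cc_sqr_le M f : Cc M f ->
  (c^-1 * \int[leb]_(y in Q) f y) ^+ 2 <= c^-1 * ip leb f f.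
Proof.
move=> cf; apply: le_trans (avg_sqr_le _ _) _.
- exact: (Cc_integrableQ cf).
- exact: (Cc_integrableQ (Cc_sqr cf)).
rewrite ler_wpM2l ?invr_ge0 ?(ltW cube_gt0)//.
rewrite -lee_fin (ipE (Cc_L2 cf)) /Rintegral fineK; last first.
  by apply: integrable_fin_num => //; exact: (Cc_integrableQ (Cc_sqr cf)).
have /integrableP[mf2 _] := Cc_integrable (Cc_sqr cf).
apply: (ge0_subset_integral leb mQ measurableT mf2) => [x _|]; last exact: subsetT.
by rewrite lee_fin sqr_ge0.
Qed.

Lemma cube_avg_sqr_le M phi x : Cc M phi ->
  cube_avg e phi x ^+ 2 <= c^-1 * ip leb phi phi.
Proof.
move=> cphi; rewrite -(integral_translate_sqr x cphi).
exact: (avg_Cc_sqr_le (Cc_translate x cphi)).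
Qed.

Lemma cube_avgB M phi psi x : Cc M phi -> Cc M psi ->
  cube_avg e (phi \- psi) x = cube_avg e phi x - cube_avg e psi x.
Proof.
move=> cphi cpsi; rewrite /cube_avg -mulrBr -RintegralB//.
- exact: (Cc_integrableQ (Cc_translate x cphi)).
- exact: (Cc_integrableQ (Cc_translate x cpsi)).
Qed.

Lemma cube_avg_lipschitz M phi x x' (r : R) : C1c M phi -> `|x - x'| <= r ->
  (cube_avg e phi x - cube_avg e phi x') ^+ 2 <=
  c^-1 * (n.+1%:R * r ^+ 2 * dirichlet_energy phi).
Proof.
move=> cphi xr; have [cphi0 _ _] := cphi.
pose h z := phi (z + (x - x')) - phi z.
have ch : Cc (M + `|x - x'|) h.
  by apply: CcB; [exact: Cc_translate|apply: CcS cphi0; rewrite lerDl].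
have -> : cube_avg e phi x - cube_avg e phi x' =
    c^-1 * \int[leb]_(y in Q) h (y + x').
  rewrite /cube_avg -mulrBr -RintegralB//; last 2 first.
  - exact: (Cc_integrableQ (Cc_translate x cphi0)).
  - exact: (Cc_integrableQ (Cc_translate x' cphi0)).
  congr (_ * _); apply: eq_Rintegral => y _.
  by rewrite /h -addrA [x' + _]addrC subrK.
apply: le_trans (avg_Cc_sqr_le (Cc_translate x' ch)) _.
rewrite ler_wpM2l ?invr_ge0 ?(ltW cube_gt0)//.
rewrite (integral_translate_sqr _ ch).
exact: translate_le cphi xr.
Qed.

(** Where the averages are small, the norm of [psi] is controlled by its energy.
    The proof compares [psi x] with its average, using Jensen's inequality, and
    integrates [(psi (x + y) - psi x)^2] over [x] before [y]. *)
Lemma ip_cube_avg_le M psi (s : R) : 0 <= s -> C1c M psi ->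
  (forall x, `|x| <= M -> cube_avg e psi x ^+ 2 <= s) ->
  ip leb psi psi <= 2 * (n.+1%:R * e ^+ 2 * dirichlet_energy psi) +
                    2 * s * fine (leb (cball M)).
Proof.
move=> s0 cpsi avg_s; have [cpsi0 _ _] := cpsi; have [cont psi0] := cpsi0.
have mpsi : measurable_fun setT psi by exact: continuous_measurable_rV.
pose K (z : T * T) := (\1_Q z.2 * (psi (z.1 + z.2) - psi z.1) ^+ 2)%:E.
have K0 z : (0 <= K z)%E by rewrite lee_fin mulr_ge0// sqr_ge0.
have mK : measurable_fun setT K.
  apply/measurable_EFinP; apply: measurable_funM.
    exact: (measurableT_comp (measurable_indic mQ) measurable_snd).
  apply: measurable_funX; apply: measurable_funB.
    exact: continuous_add_measurable.
  exact: (measurableT_comp mpsi measurable_fst).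
pose F x := (\int[leb]_y K (x, y))%E.
have mF : measurable_fun setT F.
  exact: (measurable_fun_fubini_tonelli_F (m2 := leb) K mK K0).
have F0 x : (0 <= F x)%E by exact: integral_ge0.
pose E := n.+1%:R * e ^+ 2 * dirichlet_energy psi.
have E0 : 0 <= E by rewrite mulr_ge0 ?dirichlet_energy_ge0// mulr_ge0// sqr_ge0.
have intF : (\int[leb]_x F x <= (E * c)%:E)%E.
  rewrite /F (fubini_tonelli K mK)//.
  apply: (@le_trans _ _ (\int[leb]_y (E * \1_Q y)%:E)%E).
    apply: ge0_le_integral.
    - exact: measurableT.
    - by move=> y _; exact: integral_ge0.
    - exact: (measurable_fun_fubini_tonelli_G (m1 := leb) K mK K0).
    - apply/measurable_EFinP; apply: measurable_funM; first exact: measurable_cst.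
      exact: measurable_indic.
    move=> y _; rewrite /K /= indicE; have [/set_mem yQ|_] := boolP (y \in Q).
      under eq_integral => x _ do rewrite mul1r.
      rewrite -ipE; last first.
        apply: (@Cc_L2 _ _ (M + `|y|)).
        by apply: CcB; [exact: Cc_translate|apply: CcS cpsi0; rewrite lerDl].
      rewrite lee_fin mulr1; apply: (translate_le cpsi).
      exact: cube_norm (ltW e_gt0) yQ.
    under eq_integral => x _ do rewrite mul0r.
    by rewrite integral0 mulr0.
  under eq_integral => y _ do rewrite EFinM.
  have mI : measurable_fun setT (EFin \o (\1_Q : T -> R)).
    by apply/measurable_EFinP; exact: measurable_indic.
  rewrite (ge0_integralZl leb measurableT mI).
  - by rewrite integral_indic ?setIT// [(E * c)%:E]EFinM /c /Q cube_fineK.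
  - by move=> y _; rewrite lee_fin.
  - by rewrite lee_fin.
have pt x : ((psi x ^+ 2)%:E <= (2 * c^-1)%:E * F x + (2 * s * \1_(cball M) x)%:E)%E.
  have c2 : 0 <= 2 * c^-1 by rewrite mulr_ge0// invr_ge0 (ltW cube_gt0).
  have [xM|xM] := leP `|x| M; last first.
    rewrite psi0// expr0n adde_ge0 ?mule_ge0// lee_fin.
    by rewrite indicE memNset ?mulr0// => /=; rewrite /cball/= leNgt xM.
  have intQ (a : R) : leb.-integrable Q (EFin \o cst a) := integrable_cst_fin a mQ Qoo.
  have ct := Cc_integrableQ (Cc_translate x cpsi0).
  pose g y := psi (y + x) - psi x.
  have intg : leb.-integrable Q (EFin \o g).
    exact: (integrableB mQ ct (intQ (psi x))).
  have intg2 : leb.-integrable Q (fun y => (g y ^+ 2)%:E).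
    have := integrableD mQ (Cc_integrableQ (Cc_sqr (Cc_translate x cpsi0)))
      (integrableD mQ (integrableZl mQ (- 2 * psi x) ct) (intQ (psi x ^+ 2))).
    apply: eq_integrable => // y _ /=; rewrite -!EFinM -!EFinD; congr EFin.
    by rewrite /g; ring.
  have -> : F x = (\int[leb]_(y in Q) (g y ^+ 2))%:E.
    rewrite /Rintegral fineK; last exact: integrable_fin_num.
    rewrite integral_mkcond; apply: eq_integral => y _.
    rewrite /K/= /patch indicE; case: ifPn => _; last by rewrite mul0r.
    by rewrite mul1r /g [x + y]addrC.
  rewrite -EFinM -EFinD lee_fin indicE mem_set// mulr1.
  have -> : psi x = cube_avg e psi x - c^-1 * \int[leb]_(y in Q) g y.
    have -> : \int[leb]_(y in Q) g y = \int[leb]_(y in Q) psi (y + x) - psi x * c.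
      by rewrite -(Rintegral_cst leb mQ) -(RintegralB mQ ct (intQ _)).
    by rewrite mulrBr [_ * (psi x * c)]mulrCA mulVf ?gt_eqF// mulr1 subKr.
  set a := cube_avg e psi x; have := avg_s _ xM; rewrite -/a => a_s.
  have := avg_sqr_le intg intg2.
  set b := c^-1 * \int[leb]_(y in Q) g y => b_le.
  have : (a - b) ^+ 2 <= 2 * a ^+ 2 + 2 * b ^+ 2.
    by have := sqr_ge0 (a + b); rewrite !expr2; lra.
  by rewrite -mulrA; lra.
rewrite -lee_fin (ipE (Cc_L2 cpsi0)).
apply: (@le_trans _ _ (\int[leb]_x
    ((2 * c^-1)%:E * F x + (2 * s * \1_(cball M) x)%:E))%E).
  apply: ge0_le_integral.
  - exact: measurableT.
  - by move=> x _; rewrite lee_fin sqr_ge0.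
  - by have /integrableP[] := Cc_integrable (Cc_sqr cpsi0).
  - apply: emeasurable_funD; first exact: measurable_funeM.
    by have /integrableP[] := cball_indic_integrable n M (2 * s).
  - by move=> x _; exact: pt.
have c2 : 0 <= 2 * c^-1 by rewrite mulr_ge0// invr_ge0 (ltW cube_gt0).
have mI : measurable_fun setT (EFin \o (\1_(cball M) : T -> R)).
  by apply/measurable_EFinP/measurable_indic; exact: cball_measurable.
rewrite (ge0_integralD leb measurableT); last 4 first.
- by move=> x _; rewrite mule_ge0// lee_fin.
- exact: measurable_funeM.
- by move=> x _; rewrite lee_fin mulr_ge0// mulr_ge0.
- by have /integrableP[] := cball_indic_integrable n M (2 * s).
rewrite (ge0_integralZl leb measurableT mF)//.
under [X in (_ + X)%E]eq_integral => x _ do rewrite EFinM.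
rewrite (ge0_integralZl leb measurableT mI); last 2 first.
- by move=> x _; rewrite lee_fin.
- by rewrite lee_fin mulr_ge0.
rewrite [X in (_ + _ * X)%E](_ : _ = leb (cball M)); last first.
  by rewrite /= integral_indic ?setIT//; exact: cball_measurable.
rewrite [in leRHS]EFinD; apply: leeD.
  apply: le_trans (lee_wpmul2l _ intF) _; first by rewrite lee_fin.
  rewrite -EFinM lee_fin (_ : 2 * c^-1 * (E * c) = 2 * E)//.
  by rewrite [E * c]mulrC mulrA mulfVK// gt_eqF.
rewrite [in leRHS]EFinM fineK// ge0_fin_numE//; exact: cball_lty.
Qed.

End cube_average.

End compactness.

(** * Rellich compactness for C^1 functions of bounded support *)

Section ultrafilter_extraction.
Variable R : realType.

Lemma ultra_bounded_cauchy (U : set_system nat) (a : nat -> R) (B eta : R) :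
  UltraFilter U -> (forall k, `|a k| <= B) -> 0 < eta ->
  exists2 S, U S & forall k l, S k -> S l -> `|a k - a l| <= eta.
Proof.
move=> UU aB eta0.
have PU : ProperFilter U by exact: ultra_proper.
have Ua : UltraFilter (a @ U).
  split; first exact: fmap_proper_filter.
  move=> G PG aG; apply/seteqP; split=> [A GA|]; last exact: aG.
  have [//|UnA] := in_ultra_setVsetC (a @^-1` A) UU.
  have GnA : G (~` A) by exact: aG.
  by have [x []] := filter_ex (filterI GA GnA).
have := @segment_compact R (- B) B; rewrite compact_ultra => /(_ _ Ua).
case.
  rewrite /fmap/=; apply: filterS filterT => k _.
  by rewrite /= in_itv/= -ler_norml.
move=> l [_ /= /cvgrPdist_le /(_ (eta / 2))].
rewrite divr_gt0// => /(_ isT) al.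
exists [set k | `|l - a k| <= eta / 2] => // k j /= kl jl.
rewrite -(subrKA l) (le_trans (ler_normD _ _))// [eta]splitr lerD//.
by rewrite distrC.
Qed.

(** A sequence that is Cauchy along a free ultrafilter has a Cauchy subsequence.
    The terms [s k] need only tend to infinity. *)
Lemma ultra_cauchy_subseq (U : set_system nat) (dist : nat -> nat -> R) :
  UltraFilter U -> \oo `<=` U ->
  (forall e : R, 0 < e -> exists2 S, U S & forall k l, S k -> S l -> dist k l <= e) ->
  exists2 s : nat -> nat, (forall k, k <= s k)%N &
    forall e : R, 0 < e -> exists K, forall i j, (K <= i)%N -> (K <= j)%N ->
      dist (s i) (s j) <= e.
Proof.
move=> UU ooU smallS.
have PU : ProperFilter U by exact: ultra_proper.
have /choice[S SP] : forall k : nat, exists S, U S /\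
    forall i j, S i -> S j -> dist i j <= k.+1%:R^-1.
  by move=> k; have [S US SP] := smallS _ (harmonic_gt0 k); exists S.
have UI k : U (\bigcap_(i < k.+1) S i `&` [set j | (k <= j)%N]).
  apply: filterI; last by apply: ooU; exists k.
  rewrite bigcap_mkord; elim/big_ind: _ => [|A B|i _]; first exact: filterT.
    exact: filterI.
  by have [] := SP i.
have /choice[s sP] : forall k, exists j,
    (\bigcap_(i < k.+1) S i `&` [set j | (k <= j)%N]) j.
  by move=> k; exact: filter_ex (UI k).
exists s => [k|e e0]; first by have [] := sP k.
have [K _ KP] := near_infty_natSinv_lt (PosNum e0).
exists K => i j Ki Kj; apply: le_trans (ltW (KP K (leqnn K))).
have [_ SK] := SP K; apply: SK.
  by have [+ _] := sP i; apply; rewrite /= ltnS.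
by have [+ _] := sP j; apply; rewrite /= ltnS.
Qed.

End ultrafilter_extraction.

Section rellich.
Variables (R : realType) (n : nat).
Local Notation T := 'rV[R]_n.+1.
Local Notation leb := (@lebesgue_rV R n).

(** A ball of radius [M] has a finite [r]-net, made of lattice points. *)
Lemma cball_net (M r : R) : 0 < r ->
  exists (I : finType) (p : I -> T), forall x, `|x| <= M ->
    exists i, `|x - p i| <= r.
Proof.
move=> r0; pose m := (Num.truncn ((M + M) / r)).+1.
exists ({ffun 'I_n.+1 -> 'I_m} : finType),
  (fun f : {ffun 'I_n.+1 -> 'I_m} => \row_i (r * (f i)%:R - M)) => x xM.
have xi i : 0 <= x ord0 i + M <= M + M.
  have := le_trans (norm_coord_le x i) xM; rewrite ler_norml => /andP[? ?].
  by apply/andP; split; lra.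
have q_ge0 i : 0 <= (x ord0 i + M) / r.
  by rewrite divr_ge0 ?(ltW r0)//; case/andP: (xi i).
have lt_m i : (Num.truncn ((x ord0 i + M) / r) < m)%N.
  rewrite ltnS; apply: le_truncn.
  by rewrite ler_wpM2r ?invr_ge0 ?(ltW r0)//; case/andP: (xi i).
exists [ffun i => Ordinal (lt_m i)].
rewrite /Num.norm/= mx_normrE; apply: bigmax_le; first exact: ltW.
move=> -[k i] _ /=; rewrite !mxE ffunE (ord1 k) /=.
have /andP[] := truncn_itv (q_ge0 i).
set t := Num.truncn _; rewrite ler_pdivlMr// ltr_pdivrMr// => lo hi.
by rewrite ler_norml; apply/andP; split; move: hi; rewrite -natr1; lra.
Qed.

Lemma ler_sum2 (I : finType) (f g h : I -> R) :
  (forall i, f i <= 2 * g i + 2 * h i) ->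
  \sum_i f i <= 2 * \sum_i g i + 2 * \sum_i h i.
Proof.
by move=> fgh; rewrite !mulr_sumr -big_split /=; apply: ler_sum => i _.
Qed.

Lemma dirichlet_energy_leB M phi psi : C1c M phi -> C1c M psi ->
  dirichlet_energy (phi \- psi) <=
  2 * dirichlet_energy phi + 2 * @dirichlet_energy R n psi.
Proof.
move=> cphi cpsi; have [_ dB] := C1cB cphi cpsi.
apply: ler_sum2 => i; rewrite dB.
have [_ _ c1] := cphi; have [_ _ c2] := cpsi.
exact: (psd_form_leB (L2_subspace leb) (ip_psd leb) (Cc_L2 (c1 i)) (Cc_L2 (c2 i))).
Qed.

Lemma null_ip (f : T -> R) : L2 leb f -> leb setT = 0%E -> ip leb f f = 0.
Proof.
move=> lf null; have /integrableP[mff _] := L2_integrable_mul lf lf.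
by rewrite /ip /Rintegral (null_set_integral measurableT mff null).
Qed.

(** Rellich's theorem for functions supported in a fixed ball. *)
Lemma C1c_precompact (M C : R) (phi : nat -> T -> R) :
  (forall k, C1c M (phi k)) -> (forall k, ip leb (phi k) (phi k) <= C) ->
  (forall k, dirichlet_energy (phi k) <= C) ->
  exists2 s : nat -> nat, (forall k, k <= s k)%N &
    forall e : R, 0 < e -> exists K, forall i j, (K <= i)%N -> (K <= j)%N ->
      ip leb (phi (s i) \- phi (s j)) (phi (s i) \- phi (s j)) <= e.
Proof.
move=> cphi ipC enC.
(* If the whole space were null, all norms would vanish. *)
have [null|pos] := eqVneq (leb setT) 0%E.
  exists id => // e e0; exists 0%N => i j _ _.
  have [cij _] := C1cB (cphi i) (cphi j); have [c0 _ _] := cij.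
  by rewrite (null_ip (Cc_L2 c0) null) ltW.
have C0 : 0 <= C by exact: le_trans (dirichlet_energy_ge0 _) (enC 0%N).
have [U [UU ooU]] := @ultraFilterLemma nat \oo _.
apply: (@ultra_cauchy_subseq R U (fun k l => ip leb (phi k \- phi l)
  (phi k \- phi l)) UU ooU) => delta delta0.
have half_div (a b : R) : 0 < b -> a / (2 * b) * b = a / 2.
  by move=> b0; field; rewrite gt_eqF.
pose A := 8 * n.+1%:R * C + 1.
have A0 : 0 < A by rewrite ltr_wpDl// !mulr_ge0.
(* The side e makes the energy term of ip_cube_avg_le at most delta / 2. *)
pose e := Num.sqrt (delta / (2 * A)).
have e0 : 0 < e by rewrite sqrtr_gt0 divr_gt0// mulr_gt0.
have e2 : e ^+ 2 * A = delta / 2.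
  by rewrite sqr_sqrtr ?half_div// ltW// divr_gt0// mulr_gt0.
have c0 : 0 < fine (leb (cube e)).
  rewrite lt0r fine_ge0// andbT; apply: contra_neq pos => c0.
  by apply: (lebesgue_box0_null e0); rewrite -cube_fineK c0.
set c := fine (leb (cube e)) in c0.
pose V := fine (leb (cball M : set T)).
have V0 : 0 <= V by exact: fine_ge0.
(* A bound s on the squared averages makes the other term at most delta / 2. *)
pose s := delta / (4 * (V + 1)).
have s0 : 0 < s by rewrite divr_gt0// mulr_gt0// ltr_wpDl.
have sV : 2 * s * V <= delta / 2.
  rewrite (_ : delta / 2 = 2 * s * (V + 1)).
    by rewrite ler_wpM2l ?lerDl// mulr_ge0// ltW.
  have V1 : 0 < V + 1 by rewrite ltr_wpDl.
  by rewrite /s; field; rewrite gt_eqF.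
pose B := 8 * c^-1 * n.+1%:R * C + 1.
have B0 : 0 < B by rewrite ltr_wpDl// !mulr_ge0// invr_ge0 ltW.
(* Over a distance r the squared variation of the averages is at most s / 4. *)
pose r := Num.sqrt (s / (2 * B)).
have r0 : 0 < r by rewrite sqrtr_gt0 divr_gt0// mulr_gt0.
have r2 : r ^+ 2 * B = s / 2.
  by rewrite sqr_sqrtr ?half_div// ltW// divr_gt0// mulr_gt0.
pose eta := Num.sqrt (s / 4).
have eta0 : 0 < eta by rewrite sqrtr_gt0 divr_gt0.
have eta2 : eta ^+ 2 = s / 4 by rewrite sqr_sqrtr// divr_ge0// ltW.
have [I [p pP]] := cball_net M r0.
have cphi0 k : Cc M (phi k) by case: (cphi k).
have avgB (x : T) : exists B, forall k, `|cube_avg e (phi k) x| <= B.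
  (* The averages at a given point are bounded uniformly in k. *)
  exists (Num.sqrt (c^-1 * C)) => k.
  rewrite -sqrtr_sqr ler_wsqrtr// (le_trans (cube_avg_sqr_le c0 x (cphi0 k)))//.
  by rewrite ler_wpM2l// invr_ge0 ltW.
have /choice[S SP] : forall i, exists S, U S /\ forall k l, S k -> S l ->
    `|cube_avg e (phi k) (p i) - cube_avg e (phi l) (p i)| <= eta.
  move=> i; have [Bi BiP] := avgB (p i).
  by have [S US SP] := ultra_bounded_cauchy UU BiP eta0; exists S.
have PU : ProperFilter U by exact: ultra_proper.
exists [set k | forall i, S i k].
  by apply: filter_forall => i; have [] := SP i.
move=> k l Sk Sl.
have [cpsi _] := C1cB (cphi k) (cphi l).
have enpsi : dirichlet_energy (phi k \- phi l) <= 4 * C.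
  apply: le_trans (dirichlet_energy_leB (cphi k) (cphi l)) _.
  rewrite (_ : 4 * C = 2 * C + 2 * C); last by ring.
  by rewrite lerD// ler_wpM2l.
have en0 := dirichlet_energy_ge0 (phi k \- phi l).
apply: le_trans (ip_cube_avg_le e0 c0 (ltW s0) cpsi _) _.
  move=> x /pP[i xi].
  have := cube_avg_lipschitz c0 cpsi xi.
  have [_ /(_ k l (Sk i) (Sl i))] := SP i.
  rewrite -(cube_avgB e (p i) (cphi0 k) (cphi0 l)).
  set a := cube_avg e _ x; set b := cube_avg e _ (p i) => b_le ab_le.
  have b2 : b ^+ 2 <= s / 4.
    by rewrite -eta2 -[leLHS]real_normK ?num_real// lerXn2r ?nnegrE// ltW.
  have ab2 : (a - b) ^+ 2 <= s / 4.
    apply: le_trans ab_le _.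
    apply: (@le_trans _ _ (c^-1 * (n.+1%:R * r ^+ 2 * (4 * C)))).
      by rewrite ler_wpM2l ?invr_ge0 ?(ltW c0)// ler_wpM2l// mulr_ge0// sqr_ge0.
    have -> : c^-1 * (n.+1%:R * r ^+ 2 * (4 * C)) = (r ^+ 2 * B - r ^+ 2) / 2.
      by rewrite /B; field; rewrite gt_eqF.
    by rewrite r2; have := sqr_ge0 r; lra.
  by have := sqr_ge0 (a - 2 * b); rewrite !expr2 in b2 ab2 *; lra.
rewrite -/V.
have : 2 * (n.+1%:R * e ^+ 2 * dirichlet_energy (phi k \- phi l)) <=
    2 * (n.+1%:R * e ^+ 2 * (4 * C)).
  by rewrite ler_wpM2l// ler_wpM2l// mulr_ge0// sqr_ge0.
have -> : 2 * (n.+1%:R * e ^+ 2 * (4 * C)) = e ^+ 2 * A - e ^+ 2.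
  by rewrite /A; ring.
by rewrite e2; have := sqr_ge0 e; lra.
Qed.

End rellich.

(** * Test functions and the space H^1_0 *)

Section test_functions.
Variables (R : realType) (n : nat).
Local Notation T := 'rV[R]_n.+1.
Local Notation leb := (@lebesgue_rV R n).
Variable Omega : set T.
Hypotheses (Omega_open : open Omega) (Omega_bounded : bounded_set Omega).
Implicit Types (u phi psi : T -> R) (Du : T -> 'cV[R]_n.+1).

Lemma continuous_lin (a : R) phi psi : continuous phi -> continuous psi ->
  continuous (a *: phi + psi).
Proof.
move=> cphi cpsi x; apply: continuousD; last exact: cpsi.
rewrite (_ : a *: phi = (fun x => a * phi x))//.
by apply: continuousM; [exact: cst_continuous|exact: cphi].
Qed.

Lemma Ck_lin k (a : R) phi psi : Ck k phi -> Ck k psi -> Ck k (a *: phi + psi).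
Proof.
elim: k phi psi => [|k IH] phi psi [cphi dphi] [cpsi dpsi].
  by split=> //; exact: continuous_lin.
split; first exact: continuous_lin.
move=> i; have [d1 C1] := dphi i; have [d2 C2] := dpsi i.
have dZ x : derivable (a *: phi) x (delta_mx ord0 i) by exact: derivableZ.
split; first by move=> x; exact: derivableD.
rewrite (_ : partial i _ = a *: partial i phi + partial i psi); first exact: IH.
apply/funext => x; rewrite /partial deriveD// deriveZ//.
Qed.

Lemma test_function_lin (a : R) phi psi : test_function Omega phi ->
  test_function Omega psi -> test_function Omega (a *: phi + psi).
Proof.
move=> [sphi cphi Ophi] [spsi cpsi Opsi].
have sub : supp (a *: phi + psi) `<=` supp phi `|` supp psi.
  rewrite /supp -closureU; apply: closure_subset => x /=.
  rewrite (_ : (a *: phi + psi) x = a * phi x + psi x)//.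
  have [->|] := eqVneq (phi x) 0; last by left.
  have [->|] := eqVneq (psi x) 0; last by right.
  by rewrite mulr0 addr0 eqxx.
split.
- by move=> k; exact: Ck_lin.
- apply: (subclosed_compact _ _ sub); first exact: closed_closure.
  exact: compactU.
- by move=> x /sub[/Ophi|/Opsi].
Qed.

(** Off its support a function vanishes near every point, hence so do its
    derivatives. *)
Lemma supp_out phi x : ~ supp phi x -> phi x = 0 /\ forall i, partial i phi x = 0.
Proof.
move=> nx; have oC : open (~` supp phi) by exact/closed_openC/closed_closure.
have near0 : \near x, phi x = cst 0 x.
  have : nbhs x (~` supp phi) by exact: open_nbhs_nbhs.
  apply: filterS => y ny; apply/eqP; apply: contrapT => /negP phiy.
  by apply: ny; exact: subset_closure.
split; first exact: (nbhs_singleton near0).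
by move=> i; rewrite /partial (near_eq_derive _ near0) derive_cst.
Qed.

Lemma test_function_restrict phi : test_function Omega phi ->
  phi \_ Omega = phi /\ forall i, (partial i phi) \_ Omega = partial i phi.
Proof.
move=> [_ _ Ophi]; split=> [|i]; apply/funext => x; rewrite patchE;
  case: ifPn => // /negP nx; have [] := @supp_out phi x.
- by move=> /Ophi xO; apply: nx; rewrite inE.
- by move=> ->.
- by move=> /Ophi xO; apply: nx; rewrite inE.
- by move=> _ ->.
Qed.

(** All test functions of a bounded set vanish outside a common ball. *)
Lemma test_function_C1c : exists M, forall phi, test_function Omega phi -> C1c M phi.
Proof.
have [M M0 OM] := pinfty_ex_gt0 Omega_bounded.
exists M => phi [sphi cphi Ophi].
have out x : M < `|x| -> phi x = 0 /\ forall i, partial i phi x = 0.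
  by move=> xM; apply: supp_out => /Ophi/OM /=; rewrite leNgt xM.
have [c0 d1] := sphi 1%N.
split.
- by split=> // x /out[].
- by move=> i x; case: (d1 i).
- move=> i; split; first by case: (d1 i) => _ [].
  by move=> x /out[_].
Qed.

Let mOmega : measurable Omega := open_measurable_rV Omega_open.

Lemma restrict_lin (a : R) (f g : T -> R) :
  (a *: f + g) \_ Omega = a *: f \_ Omega + g \_ Omega.
Proof.
apply/funext => x; rewrite patchE.
rewrite (_ : (a *: f \_ Omega + g \_ Omega) x =
  a * (f \_ Omega) x + (g \_ Omega) x)// !patchE.
by case: ifPn => // _; rewrite mulr0 addr0.
Qed.

Lemma restrictB (f g : T -> R) : (f \- g) \_ Omega = f \_ Omega \- g \_ Omega.
Proof. by apply/funext => x /=; rewrite !patchE; case: ifPn; rewrite ?subr0. Qed.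

Lemma Rintegral_restrict_mul (f g : T -> R) :
  \int[leb]_(x in Omega) (f x * g x) = ip leb (f \_ Omega) (g \_ Omega).
Proof.
rewrite Rintegral_mkcond; apply: eq_Rintegral => x _.
by rewrite !patchE; case: ifPn; rewrite ?mul0r.
Qed.

(** The squared L^2 distance over [Omega]. *)
Definition sqdist (u v : T -> R) : R :=
  ip leb ((u \- v) \_ Omega) ((u \- v) \_ Omega).

Lemma sqdistE (u v : T -> R) : sqdist u v =
  ip leb (u \_ Omega \- v \_ Omega) (u \_ Omega \- v \_ Omega).
Proof. by rewrite /sqdist restrictB. Qed.

(** Square-integrability over [Omega]. *)
Definition L2on (u : T -> R) := L2 leb (u \_ Omega).

Lemma L2on_lin (a : R) u v : L2on u -> L2on v -> L2on (a *: u + v).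
Proof. by move=> lu lv; rewrite /L2on restrict_lin; exact: (L2_subspace leb).2. Qed.

Lemma L2onB u v : L2on u -> L2on v -> L2on (u \- v).
Proof.
by move=> lu lv; rewrite /L2on restrictB; exact: (subspaceB (L2_subspace leb)).
Qed.

Lemma test_L2on phi : test_function Omega phi ->
  [/\ L2 leb phi, L2on phi, forall i, L2 leb (partial i phi) &
      forall i, L2on (partial i phi)].
Proof.
move=> tphi; have [M MP] := test_function_C1c.
have [c0 _ c1] := MP _ tphi; have [r0 r1] := test_function_restrict tphi.
split=> [||i|i]; rewrite /L2on ?r0 ?r1; [exact: (Cc_L2 c0)|exact: (Cc_L2 c0)| |];
  exact: (Cc_L2 (c1 i)).
Qed.

Lemma sqdist_triangle u v w : L2on u -> L2on v -> L2on w ->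
  sqdist u w <= 2 * sqdist u v + 2 * sqdist v w.
Proof.
move=> lu lv lw; rewrite /sqdist.
rewrite (_ : (u \- w) \_ Omega = (u \- v) \_ Omega + (v \- w) \_ Omega).
  by apply: (psd_form_leD (L2_subspace leb) (ip_psd leb)); exact: L2onB.
apply/funext => x; rewrite (_ : ((u \- v) \_ Omega + (v \- w) \_ Omega) x =
  ((u \- v) \_ Omega) x + ((v \- w) \_ Omega) x)// !patchE.
by case: ifPn => _ /=; rewrite ?addr0// subrKA.
Qed.

Lemma sqdistC u v : sqdist u v = sqdist v u.
Proof.
rewrite /sqdist !restrictB /ip; apply: eq_Rintegral => x _ /=.
by rewrite -!expr2 -sqrrN opprB.
Qed.

(** [u] and [Du] are approximated to any precision in L^2 by a test function and
    its gradient.  By [H10P] this is what singles out H^1_0 within H^1. *)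
Definition approximable u Du := forall e : R, 0 < e -> exists phi,
  [/\ test_function Omega phi, sqdist phi u <= e &
      forall i, sqdist (partial i phi) (fun x => Du x i ord0) <= e].

Lemma H10P u Du : H10 Omega u Du <-> H1 Omega u Du /\ approximable u Du.
Proof.
split=> -[h1]; have [lu lDu _] := h1.
  move=> [phi [tphi /cvg_Lnorm2P cu cD]]; split=> // e e0.
  have [|K0 K0P] := cu _ e e0.
    by move=> k; have [_ l _ _] := test_L2on (tphi k); exact: (L2onB l lu).
  have /choice[K KP] : forall i, exists K : nat, forall k, (K <= k)%N ->
      sqdist (partial i (phi k)) (fun x => Du x i ord0) <= e.
    move=> i; have /cvg_Lnorm2P/(_ e e0) := cD i; apply => k.
    by have [_ _ _ l] := test_L2on (tphi k); exact: (L2onB (l i) (lDu i)).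
  pose N := maxn K0 (\max_i K i).
  exists (phi N); split=> // [|i]; first by apply: K0P; exact: leq_maxl.
  apply: KP; apply: leq_trans (leq_maxr _ _); exact: leq_bigmax.
move=> app; split=> //.
have /choice[phi phiP] := fun k => app _ (harmonic_gt0 k).
exists phi.
have tphi k : test_function Omega (phi k) by case: (phiP k).
have small (e : R) : 0 < e -> exists K : nat, forall k, (K <= k)%N -> k.+1%:R^-1 <= e.
  move=> e0; have [K _ KP] := near_infty_natSinv_lt (PosNum e0).
  by exists K => k Kk; exact: ltW (KP _ Kk).
split=> // [|i].
  apply/cvg_Lnorm2P => [k|e /small[K KP]].
    by have [_ l _ _] := test_L2on (tphi k); exact: (L2onB l lu).
  by exists K => k Kk; apply: le_trans (KP _ Kk); case: (phiP k).
apply/cvg_Lnorm2P => [k|e /small[K KP]].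
  by have [_ _ _ l] := test_L2on (tphi k); exact: (L2onB (l i) (lDu i)).
exists K => k Kk; apply: le_trans (KP _ Kk).
by have [_ _ dk] := phiP k; exact: dk.
Qed.

(** Test functions vanish outside [Omega], so that the integrals over [Omega] are
    inner products over the whole space. *)
Lemma weak_gradientP u Du : weak_gradient Omega u Du <->
  forall phi i, test_function Omega phi ->
    ip leb (u \_ Omega) (partial i phi) =
    - ip leb ((fun x => Du x i ord0) \_ Omega) phi.
Proof.
split=> h phi i tphi; have := h phi i tphi;
  have [r0 r1] := test_function_restrict tphi;
  by rewrite (Rintegral_restrict_mul u) Rintegral_restrict_mul r0 r1.
Qed.

Lemma H10_lin (a : R) u Du v Dv : H10 Omega u Du -> H10 Omega v Dv ->
  H10 Omega (a *: u + v) (a *: Du + Dv).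
Proof.
move=> /H10P[[lu lDu /weak_gradientP wu] au] /H10P[[lv lDv /weak_gradientP wv] av].
have comp i : (fun x => (a *: Du + Dv) x i ord0) =
    a *: (fun x => Du x i ord0) + (fun x => Dv x i ord0).
  by apply/funext => x; rewrite !fctE !mxE.
have l1 : L2on (a *: u + v) by exact: L2on_lin.
have l2 i : L2on (fun x => (a *: Du + Dv) x i ord0).
  by rewrite comp; exact: (L2on_lin _ (lDu i) (lDv i)).
apply/H10P; split.
  split=> //; apply/weak_gradientP => phi i tphi.
  have [lphi _ lD _] := test_L2on tphi; have [lin _ _] := ip_psd leb.
  rewrite comp !restrict_lin (lin a _ _ _ lu lv (lD i)).
  rewrite (lin a _ _ _ (lDu i) (lDv i) lphi) (wu _ _ tphi) (wv _ _ tphi).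
  by rewrite mulrN -opprD.
move=> e e0.
have e'0 : 0 < e / (4 * (a ^+ 2 + 1)).
  by rewrite divr_gt0// mulr_gt0// ltr_wpDl// sqr_ge0.
have [phi [tphi pu pD]] := au _ e'0; have [psi [tpsi qv qD]] := av _ e'0.
have [_ lphi _ lDphi] := test_L2on tphi; have [_ lpsi _ lDpsi] := test_L2on tpsi.
have dist (f1 f2 g1 g2 : T -> R) : L2on f1 -> L2on f2 -> L2on g1 -> L2on g2 ->
    sqdist f1 g1 <= e / (4 * (a ^+ 2 + 1)) ->
    sqdist f2 g2 <= e / (4 * (a ^+ 2 + 1)) ->
    sqdist (a *: f1 + f2) (a *: g1 + g2) <= e.
  move=> lf1 lf2 lg1 lg2 d1 d2; rewrite /sqdist.
  have -> : (a *: f1 + f2) \- (a *: g1 + g2) = a *: (f1 \- g1) + (f2 \- g2).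
    apply/funext => x; suff : (a * f1 x + f2 x) - (a * g1 x + g2 x) =
      a * (f1 x - g1 x) + (f2 x - g2 x) by exact.
    by ring.
  rewrite restrict_lin.
  have ld1 := L2onB lf1 lg1; have ld2 := L2onB lf2 lg2.
  have lz := subspaceZ (L2_subspace leb) a ld1.
  apply: le_trans (psd_form_leD (L2_subspace leb) (ip_psd leb) lz ld2) _.
  rewrite (psd_formZ (L2_subspace leb) (ip_psd leb) a ld1) -!/(sqdist _ _).
  apply: (@le_trans _ _ (2 * (a ^+ 2 * (e / (4 * (a ^+ 2 + 1)))) +
      2 * (e / (4 * (a ^+ 2 + 1))))).
    by rewrite lerD// ler_wpM2l// ler_wpM2l// sqr_ge0.
  have a1 : 0 < a ^+ 2 + 1 by rewrite ltr_wpDl// sqr_ge0.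
  rewrite (_ : _ + _ = e / 2); last by field; rewrite gt_eqF.
  by rewrite ler_pdivrMr// ler_pMr// ler1n.
exists (a *: phi + psi); split.
- exact: test_function_lin.
- exact: dist.
- move=> i; rewrite comp.
  have -> : partial i (a *: phi + psi) = a *: partial i phi + partial i psi.
    have [M MP] := test_function_C1c.
    have [_ d1 _] := MP _ tphi; have [_ d2 _] := MP _ tpsi.
    apply/funext => x; rewrite /partial deriveD ?deriveZ//.
    exact: derivableZ.
  by apply: dist => //; [exact: lDu|exact: lDv].
Qed.

End test_functions.

(** * Compactness and completeness of H^1_0 *)

Section H10_compactness.
Variables (R : realType) (n : nat).
Local Notation T := 'rV[R]_n.+1.
Local Notation leb := (@lebesgue_rV R n).
Variable Omega : set T.
Hypotheses (Omega_open : open Omega) (Omega_bounded : bounded_set Omega).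
Let mOmega : measurable Omega := open_measurable_rV Omega_open.
Local Notation sqdist := (sqdist Omega).

Lemma sqnorm_le (f g : T -> R) : L2on Omega f -> L2on Omega g ->
  ip leb (f \_ Omega) (f \_ Omega) <=
  2 * sqdist f g + 2 * ip leb (g \_ Omega) (g \_ Omega).
Proof.
move=> lf lg.
have := psd_form_leD (L2_subspace leb) (ip_psd leb) (L2onB lf lg) lg.
rewrite (_ : (f \- g) \_ Omega + g \_ Omega = f \_ Omega)//.
by apply/funext => x; rewrite restrictB -[RHS](subrK ((g \_ Omega) x)).
Qed.

Lemma harmonic_le1 k : k.+1%:R^-1 <= 1 :> R.
Proof. by rewrite invf_le1 ?ltr0Sn// ler1n. Qed.

(** Replace each function by a test function at distance at most [1 / (k + 1)]
    and apply [C1c_precompact]. *)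
Lemma H10_precompact (C : R) (w : nat -> T -> R) (Dw : nat -> T -> 'cV[R]_n.+1) :
  (forall k, H10 Omega (w k) (Dw k)) ->
  (forall k, ip leb (w k \_ Omega) (w k \_ Omega) <= C) ->
  (forall k i, ip leb ((fun x => Dw k x i ord0) \_ Omega)
                      ((fun x => Dw k x i ord0) \_ Omega) <= C) ->
  exists2 s : nat -> nat, (forall k, k <= s k)%N &
    forall e : R, 0 < e -> exists K, forall i j, (K <= i)%N -> (K <= j)%N ->
      sqdist (w (s i)) (w (s j)) <= e.
Proof.
move=> Hw wC DwC.
have app k := (iffLR (H10P Omega_bounded (w k) (Dw k)) (Hw k)).
have lw k : L2on Omega (w k) by case: (app k) => -[].
have lDw k i : L2on Omega (fun x => Dw k x i ord0).
  by case: (app k) => -[_ + _] _; exact.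
have /choice[phi phiP] := fun k => (app k).2 _ (harmonic_gt0 k).
have tphi k : test_function Omega (phi k) by case: (phiP k).
have [M MP] := test_function_C1c Omega_bounded.
pose C' := 2 + 2 * C.
have bound (f g : T -> R) k : L2on Omega f -> L2on Omega g ->
    sqdist f g <= k.+1%:R^-1 -> ip leb (g \_ Omega) (g \_ Omega) <= C ->
    ip leb (f \_ Omega) (f \_ Omega) <= C'.
  move=> lf lg fg gC; apply: le_trans (sqnorm_le lf lg) _.
  rewrite lerD//; last by rewrite ler_wpM2l.
  by rewrite -[leRHS]mulr1 ler_wpM2l// (le_trans fg)// harmonic_le1.
have phiC k : ip leb (phi k) (phi k) <= C'.
  have [r0 _] := test_function_restrict (tphi k); rewrite -r0.
  have [_ lphi _ _] := test_L2on Omega_bounded (tphi k).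
  by apply: (bound _ _ k lphi (lw k)) => //; case: (phiP k).
have enC k : dirichlet_energy (phi k) <= n.+1%:R * C'.
  rewrite /dirichlet_energy mulr_natl -[X in _ *+ X](card_ord n.+1) -sumr_const.
  apply: ler_sum => i _.
  have [_ r1] := test_function_restrict (tphi k); rewrite -r1.
  have [_ _ _ lphi] := test_L2on Omega_bounded (tphi k).
  by apply: (bound _ _ k (lphi i) (lDw k i)) => //; have [_ _] := phiP k; exact.
have C'0 : 0 <= C'.
  apply: le_trans (phiC 0%N); apply: Rintegral_ge0 => x _.
  by rewrite -expr2 sqr_ge0.
have phiC2 k : ip leb (phi k) (phi k) <= n.+1%:R * C'.
  by apply: le_trans (phiC k) _; rewrite ler_peMl// ler1n.
have [s sk sC] := C1c_precompact (fun k => MP _ (tphi k)) phiC2 enC.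
exists s => // e e0.
have e8 : 0 < e / 16 by rewrite divr_gt0.
have [K1 K1P] := sC _ e8.
have [K2 _ K2P] := near_infty_natSinv_lt (PosNum e8).
have lphi k : L2on Omega (phi k).
  by have [_ ? _ _] := test_L2on Omega_bounded (tphi k).
have phi_w k : (K2 <= k)%N -> sqdist (phi (s k)) (w (s k)) <= e / 16.
  move=> Kk; have [_ + _] := phiP (s k) => /le_trans; apply; apply: ltW.
  exact: (K2P (s k) (leq_trans Kk (sk k))).
exists (maxn K1 K2) => i j; rewrite !geq_max => /andP[i1 i2] /andP[j1 j2].
apply: le_trans (sqdist_triangle (lw (s i)) (lphi (s i)) (lw (s j))) _.
have d1 := phi_w i i2; rewrite sqdistC in d1.
have d2 := sqdist_triangle (lphi (s i)) (lphi (s j)) (lw (s j)).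
have d3 := phi_w j j2.
have d4 : sqdist (phi (s i)) (phi (s j)) <= e / 16.
  rewrite sqdistE; have [-> _] := test_function_restrict (tphi (s i)).
  by have [-> _] := test_function_restrict (tphi (s j)); exact: K1P.
apply: (@le_trans _ _ (2 * (e / 16) + 2 * (2 * (e / 16) + 2 * (e / 16)))).
  rewrite lerD ?ler_wpM2l// (le_trans d2)// lerD ?ler_wpM2l//.
lra.
Qed.

Lemma H10_complete (w : nat -> T -> R) (Dw : nat -> T -> 'cV[R]_n.+1) :
  (forall k, H10 Omega (w k) (Dw k)) ->
  (forall e : R, 0 < e -> exists K, forall i j, (K <= i)%N -> (K <= j)%N ->
    sqdist (w i) (w j) <= e /\
    forall l, sqdist (fun x => Dw i x l ord0) (fun x => Dw j x l ord0) <= e) ->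
  exists z Dz, H10 Omega z Dz /\
    forall e : R, 0 < e -> exists K, forall k, (K <= k)%N ->
      sqdist (w k) z <= e /\
      forall l, sqdist (fun x => Dw k x l ord0) (fun x => Dz x l ord0) <= e.
Proof.
move=> Hw cauchy.
have app k := (iffLR (H10P Omega_bounded (w k) (Dw k)) (Hw k)).
have lw k : L2on Omega (w k) by case: (app k) => -[].
have lDw k i : L2on Omega (fun x => Dw k x i ord0).
  by case: (app k) => -[_ + _] _; exact.
(* L^2 limits over the whole space, restricted to Omega afterwards *)
have limit (f : nat -> T -> R) : (forall k, L2on Omega (f k)) ->
    (forall e : R, 0 < e -> exists K, forall i j, (K <= i)%N -> (K <= j)%N ->
      sqdist (f i) (f j) <= e) ->
    exists2 g, L2on Omega g & forall e : R, 0 < e -> exists K, forall k,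
      (K <= k)%N -> sqdist (f k) g <= e.
  move=> lf cf; have [|g lg gP] := L2_complete lf.
    move=> e /cf[K KP]; exists K => i j Ki Kj.
    by have := KP _ _ Ki Kj; rewrite sqdistE.
  have [lgO _] := ip_restrict_le mOmega lg.
  exists g => // e /gP[K KP]; exists K => k Kk; apply: le_trans (KP k Kk).
  have ld : L2 leb (f k \_ Omega \- g) := subspaceB (L2_subspace leb) (lf k) lg.
  have [_] := ip_restrict_le mOmega ld.
  rewrite (_ : (f k \_ Omega \- g) \_ Omega = (f k \- g) \_ Omega)//.
  by apply/funext => x; rewrite !patchE; case: ifPn => //= xO; rewrite patchE xO.
have [||z lz zP] := limit w => //.
  by move=> e /cauchy[K KP]; exists K => i j Ki Kj; have [] := KP _ _ Ki Kj.
have /choice[g gP] : forall l, exists g, L2on Omega g /\ forall e : R, 0 < e ->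
    exists K, forall k, (K <= k)%N -> sqdist (fun x => Dw k x l ord0) g <= e.
  move=> l; have [||g lg gP] := limit (fun k x => Dw k x l ord0).
  - by move=> k; exact: lDw.
  - move=> e /cauchy[K KP]; exists K => i j Ki Kj.
    by have [_] := KP _ _ Ki Kj; exact.
  - by exists g.
pose Dz x : 'cV[R]_n.+1 := \col_l g l x.
have DzE l : (fun x => Dz x l ord0) = g l by apply/funext => x; rewrite mxE.
have conv (e : R) : 0 < e -> exists K, forall k, (K <= k)%N ->
    sqdist (w k) z <= e /\
    forall l, sqdist (fun x => Dw k x l ord0) (fun x => Dz x l ord0) <= e.
  move=> e0; have [K0 K0P] := zP _ e0.
  have /choice[K KP] := fun l => (gP l).2 _ e0.
  exists (maxn K0 (\max_l K l)) => k; rewrite geq_max => /andP[k0 k1].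
  split=> [|l]; first exact: K0P.
  by rewrite DzE; apply: KP; apply: leq_trans k1; exact: leq_bigmax.
exists z, Dz; split=> //.
have lDz l : L2on Omega (fun x => Dz x l ord0) by rewrite DzE; case: (gP l).
apply/H10P => //; split.
  split=> //; apply/weak_gradientP => phi i tphi.
  have [lphi _ lD _] := test_L2on Omega_bounded tphi.
  apply/eqP; rewrite -subr_eq0 -normr_le0; apply/ler_addgt0Pl => e e0; rewrite addr0.
  have e2 : 0 < e / 2 by rewrite divr_gt0.
  have [|K1 K1P] := ip_cvgl lw lz (lD i) _ e2.
    move=> d /conv[K KP]; exists K => k /KP[+ _].
    by rewrite sqdistE.
  have [|K2 K2P] := ip_cvgl (fun k => lDw k i) (lDz i) lphi _ e2.
    move=> d /conv[K KP]; exists K => k /KP[_ /(_ i)].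
    by rewrite sqdistE.
  pose k := maxn K1 K2.
  have := K1P k (leq_maxl _ _); have := K2P k (leq_maxr _ _).
  have [[_ _ /weak_gradientP wk] _] := app k; rewrite (wk _ _ tphi).
  set a := ip _ (_ \_ _) phi; set b := ip _ _ phi; set c := ip _ _ _.
  rewrite !ler_norml => /andP[? ?] /andP[? ?]; apply/andP; split; lra.
move=> e e0.
have e4 : 0 < e / 4 by rewrite divr_gt0.
have [K KP] := conv _ e4; have [d1 d2] := KP K (leqnn K).
have [_ /(_ _ e4)[phi [tphi p1 p2]]] := app K.
have [_ lphi _ lDphi] := test_L2on Omega_bounded tphi.
have quarter (a b c : R) : a <= 2 * b + 2 * c -> b <= e / 4 -> c <= e / 4 -> a <= e.
  by move=> ? ? ?; lra.
exists phi; split=> // [|i].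
  exact: quarter (sqdist_triangle lphi (lw K) lz) p1 d1.
exact: quarter (sqdist_triangle (lDphi i) (lDw K i) (lDz i)) (p2 i) (d2 i).
Qed.

End H10_compactness.

(** * The Dirichlet form of a bounded matrix field *)

Section dirichlet_form_theory.
Variables (R : realType) (n : nat).
Local Notation T := 'rV[R]_n.+1.
Local Notation leb := (@lebesgue_rV R n).
Variable Omega : set T.

Implicit Types (B : T -> 'M[R]_n.+1) (Du Dv Dw : T -> 'cV[R]_n.+1).

(** The entries of [B], extended by zero, are measurable and bounded by [K]
    almost everywhere. *)
Definition bounded_coefficients B (K : R) := forall i j,
  measurable_fun setT ((fun x => B x i j) \_ Omega) /\
  \forall x \ae leb, `|((fun x => B x i j) \_ Omega) x| <= K.

(** Vector fields with square-integrable components over [Omega]. *)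
Definition L2grad Du := forall i, L2on Omega (fun x => Du x i ord0).

Local Notation coef B i j := ((fun x => B x i j) \_ Omega).
Local Notation comp Du i := ((fun x => Du x i ord0) \_ Omega).

Lemma dot_mulmx (M : 'M[R]_n.+1) (x y : 'cV[R]_n.+1) :
  dot (M *m x) y = \sum_i \sum_j M i j * x j ord0 * y i ord0.
Proof. by apply: eq_bigr => i _; rewrite mxE mulr_suml. Qed.

Lemma Rintegral_sum (I : Type) (s : seq I) (f : I -> T -> R) :
  (forall i, leb.-integrable setT (EFin \o f i)) ->
  leb.-integrable setT (EFin \o (fun x => \sum_(i <- s) f i x)) /\
  \int[leb]_x (\sum_(i <- s) f i x) = \sum_(i <- s) \int[leb]_x f i x.
Proof.
move=> intf; elim: s => [|i s [IH1 IH2]].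
  rewrite big_nil (_ : (fun x => _) = cst 0); last by apply/funext => x; rewrite big_nil.
  split; first exact: integrable0.
  by rewrite Rintegral_cst// mul0r.
rewrite big_cons (_ : (fun x => _) = f i \+ (fun x => \sum_(j <- s) f j x)); last first.
  by apply/funext => x; rewrite big_cons.
split; first exact: (integrableD measurableT (intf i) IH1).
by rewrite RintegralD// IH2.
Qed.

Variables (B : T -> 'M[R]_n.+1) (K : R).
Hypotheses (K0 : 0 <= K) (BK : bounded_coefficients B K).

Lemma coef_L2 i j (f : T -> R) : L2 leb f ->
  L2 leb (coef B i j \* f) /\
  ip leb (coef B i j \* f) (coef B i j \* f) <= K ^+ 2 * ip leb f f.
Proof. by have [mB bB] := BK i j; exact: L2_bounded_mul. Qed.

Lemma dirichlet_formE Du Dv : L2grad Du -> L2grad Dv ->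
  leb.-integrable setT
    (EFin \o ((fun x => dot (B x *m Du x) (Dv x)) \_ Omega)) /\
  dirichlet_form Omega B Du Dv =
    \sum_i \sum_j ip leb (coef B i j \* comp Du j) (comp Dv i).
Proof.
move=> lu lv.
pose g i j x := (coef B i j \* comp Du j) x * (comp Dv i) x.
have intg i j : leb.-integrable setT (EFin \o g i j).
  by apply: L2_integrable_mul; [have [] := coef_L2 i j (lu j)|exact: lv].
have dotE : (fun x => dot (B x *m Du x) (Dv x)) \_ Omega =
    fun x => \sum_i \sum_j g i j x.
  apply/funext => x; rewrite patchE; case: ifPn => xO.
    rewrite dot_mulmx; apply: eq_bigr => i _; apply: eq_bigr => j _.
    by rewrite /g /= !patchE xO.
  rewrite big1// => i _; rewrite big1// => j _.
  by rewrite /g /= !patchE (negbTE xO) mulr0.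
have S i := Rintegral_sum (index_enum 'I_n.+1) (intg i).
have [S1 S2] := Rintegral_sum (index_enum 'I_n.+1) (fun i => (S i).1).
split; first by rewrite dotE.
rewrite /dirichlet_form Rintegral_mkcond dotE S2.
by apply: eq_bigr => i _; rewrite (S i).2.
Qed.

Lemma L2grad_lin (a : R) Du Dv : L2grad Du -> L2grad Dv -> L2grad (a *: Du + Dv).
Proof.
move=> lu lv i; rewrite (_ : (fun x => _) =
    a *: (fun x => Du x i ord0) + (fun x => Dv x i ord0)).
  exact: (L2on_lin _ (lu i) (lv i)).
by apply/funext => x; rewrite !fctE !mxE.
Qed.

Lemma dirichlet_form_linl (a : R) Du Dv Dw : L2grad Du -> L2grad Dv -> L2grad Dw ->
  dirichlet_form Omega B (a *: Du + Dv) Dw =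
  a * dirichlet_form Omega B Du Dw + dirichlet_form Omega B Dv Dw.
Proof.
move=> lu lv lw; have ld := L2grad_lin a lu lv.
rewrite (dirichlet_formE ld lw).2 (dirichlet_formE lu lw).2 (dirichlet_formE lv lw).2.
rewrite mulr_sumr -big_split; apply: eq_bigr => i _.
rewrite mulr_sumr -big_split; apply: eq_bigr => j _ /=.
have [lin _ _] := ip_psd leb.
rewrite -(lin a _ _ _ (coef_L2 i j (lu j)).1 (coef_L2 i j (lv j)).1 (lw i)).
congr ip; apply/funext => x.
suff : coef B i j x * comp (a *: Du + Dv) j x =
  a * (coef B i j x * comp Du j x) + coef B i j x * comp Dv j x by exact.
rewrite !patchE; case: ifPn => _; last by rewrite !mul0r mulr0 addr0.
by rewrite !fctE !mxE; ring.
Qed.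

Lemma dirichlet_form_linr (a : R) Du Dv Dw : L2grad Du -> L2grad Dv -> L2grad Dw ->
  dirichlet_form Omega B Dw (a *: Du + Dv) =
  a * dirichlet_form Omega B Dw Du + dirichlet_form Omega B Dw Dv.
Proof.
move=> lu lv lw; have ld := L2grad_lin a lu lv.
rewrite (dirichlet_formE lw ld).2 (dirichlet_formE lw lu).2 (dirichlet_formE lw lv).2.
rewrite mulr_sumr -big_split; apply: eq_bigr => i _.
rewrite mulr_sumr -big_split; apply: eq_bigr => j _ /=.
have [lin sym _] := ip_psd leb; have lc := (coef_L2 i j (lw j)).1.
rewrite (sym _ _ lc (ld i)) (sym _ _ lc (lu i)) (sym _ _ lc (lv i)).
rewrite -(lin a _ _ _ (lu i) (lv i) lc).
congr ip; rewrite -restrict_lin; congr (_ \_ Omega).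
by apply/funext => x; rewrite !fctE !mxE.
Qed.

(** The squared L^2 norm of a vector field over [Omega]. *)
Definition gradsq Du : R := \sum_i ip leb (comp Du i) (comp Du i).

Lemma dirichlet_form_le Du : L2grad Du ->
  dirichlet_form Omega B Du Du <= n.+1%:R * (K ^+ 2 + 1) * gradsq Du.
Proof.
move=> lu; rewrite (dirichlet_formE lu lu).2.
have [_ _ ge0] := ip_psd leb.
pose p i := ip leb (comp Du i) (comp Du i).
have p0 i : 0 <= p i by exact: (ge0 _ (lu i)).
have step i j : ip leb (coef B i j \* comp Du j) (comp Du i) <= K ^+ 2 * p j + p i.
  have [lc cle] := coef_L2 i j (lu j).
  have := psd_form_leAM (L2_subspace leb) (ip_psd leb) ltr01 lc (lu i).
  rewrite mul1r invr1 mul1r -/(p i).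
  have := ler_norm (ip leb (coef B i j \* comp Du j) (comp Du i)).
  have : 0 <= K ^+ 2 * p j by rewrite mulr_ge0// sqr_ge0.
  have := p0 i; move: cle; rewrite -/(p j).
  set x1 := ip leb _ (comp Du i); set x2 := ip leb _ _; set x3 := _ * p j.
  by lra.
apply: (@le_trans _ _ (\sum_(i < n.+1) \sum_(j < n.+1) (K ^+ 2 * p j + p i))).
  by apply: ler_sum => i _; apply: ler_sum => j _; exact: step.
rewrite le_eqVlt; apply/orP; left; apply/eqP.
under eq_bigr => i _ do rewrite big_split/= -mulr_sumr sumr_const card_ord.
rewrite big_split/= sumr_const card_ord sumrMnl.
rewrite -[_ *+ n.+1]mulr_natl -[X in _ + X]mulr_natl -/(gradsq Du); ring.
Qed.

Lemma dirichlet_form_coercive (alpha : R) Du : L2grad Du ->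
  (\forall x \ae leb, Omega x ->
    forall xi, alpha * dot xi xi <= dot (B x *m xi) xi) ->
  alpha * gradsq Du <= dirichlet_form Omega B Du Du.
Proof.
move=> lu ell; have [intB formE] := dirichlet_formE lu lu.
pose D x := (fun x => dot (B x *m Du x) (Du x)) \_ Omega x.
pose S x := \sum_i comp Du i x * comp Du i x.
have [intS SE] := Rintegral_sum (index_enum 'I_n.+1)
  (fun i => L2_integrable_mul (lu i) (lu i)).
have intaS := integrableZl measurableT alpha intS.
rewrite -subr_ge0 /gradsq -SE -RintegralZl// /dirichlet_form Rintegral_mkcond.
rewrite -RintegralB//; apply: Rintegral_ae_ge0.
  by have /integrableP[/measurable_EFinP] := integrableB measurableT intB intaS.
apply: filterS ell => x ell; rewrite patchE; case: ifPn => xO.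
  rewrite subr_ge0; apply: le_trans (ell _ (Du x)); last by rewrite inE in xO.
  rewrite le_eqVlt; apply/orP; left; apply/eqP; congr (_ * _).
  by apply: eq_bigr => i _; rewrite patchE xO.
rewrite big1 ?mulr0 ?subrr// => i _.
by rewrite patchE (negbTE xO) mulr0.
Qed.

Lemma dirichlet_form_sym Du Dv : L2grad Du -> L2grad Dv ->
  (forall x i j, B x i j = B x j i) ->
  dirichlet_form Omega B Du Dv = dirichlet_form Omega B Dv Du.
Proof.
move=> lu lv sB; apply: eq_Rintegral => x _; rewrite !dot_mulmx exchange_big.
apply: eq_bigr => i _; apply: eq_bigr => j _ /=.
by rewrite sB mulrAC.
Qed.

End dirichlet_form_theory.

(** * The Rayleigh principle for the first eigenvalue *)

Section rayleigh_dirichlet.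
Variables (R : realType) (n : nat).
Local Notation T := 'rV[R]_n.+1.
Local Notation leb := (@lebesgue_rV R n).
Variable Omega : set T.
Hypotheses (Omega_open : open Omega) (Omega_bounded : bounded_set Omega).
Variable A : T -> 'M[R]_n.+1.
Hypothesis A_elliptic : bounded_elliptic Omega A.

Lemma elliptic_bounded_coefficients :
  exists2 K, 0 <= K & bounded_coefficients Omega A K.
Proof.
have [Ainf _] := A_elliptic.
have /choice[K KP] : forall ij : 'I_n.+1 * 'I_n.+1, exists K, 0 <= K /\
    \forall x \ae leb, `|((fun x => A x ij.1 ij.2) \_ Omega) x| <= K.
  move=> [i j]; have [_ [K K0 KP]] := Lfun_infty_bounded (Ainf i j).
  by exists K.
have K0 ij : 0 <= K ij by case: (KP ij).
exists (\sum_ij K ij); first exact: sumr_ge0.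
move=> i j; have [mA _] := Lfun_infty_bounded (Ainf i j); split=> //.
have [_] := KP (i, j); apply: filterS => x /le_trans; apply.
by rewrite (bigD1 (i, j))//= lerDl sumr_ge0.
Qed.

Lemma sym_partE x i j : sym_part A x i j = 2^-1 * (A x i j + A x j i).
Proof. by rewrite !mxE. Qed.

Lemma sym_part_bounded_coefficients K : 0 <= K ->
  bounded_coefficients Omega A K -> bounded_coefficients Omega (sym_part A) K.
Proof.
move=> K0 AK i j; have [m1 b1] := AK i j; have [m2 b2] := AK j i.
have E : (fun x => sym_part A x i j) \_ Omega =
    fun x => 2^-1 * (((fun x => A x i j) \_ Omega) x + ((fun x => A x j i) \_ Omega) x).
  apply/funext => x; rewrite !patchE; case: ifPn => _; first exact: sym_partE.
  by rewrite addr0 mulr0.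
rewrite E; split.
  exact: (measurable_funM (measurable_cst _) (measurable_funD m1 m2)).
apply: filterS2 b1 b2 => x h1 h2; rewrite normrM ger0_norm ?invr_ge0//.
by rewrite ler_pdivrMl// (le_trans (ler_normD _ _))// mulr_natl mulr2n lerD.
Qed.

Lemma dot_sym_part x xi : dot (sym_part A x *m xi) xi = dot (A x *m xi) xi.
Proof.
rewrite !dot_mulmx.
have -> : \sum_i \sum_j sym_part A x i j * xi j ord0 * xi i ord0 =
  2^-1 * (\sum_i \sum_j A x i j * xi j ord0 * xi i ord0 +
          \sum_i \sum_j A x j i * xi j ord0 * xi i ord0).
  rewrite -big_split mulr_sumr; apply: eq_bigr => i _.
  rewrite -big_split mulr_sumr; apply: eq_bigr => j _ /=.
  by rewrite sym_partE; ring.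
rewrite [X in _ + X]exchange_big /=.
rewrite [X in _ + X](_ : _ = \sum_i \sum_j A x i j * xi j ord0 * xi i ord0).
  by field.
by apply: eq_bigr => i _; apply: eq_bigr => j _; rewrite mulrAC.
Qed.

Lemma dirichlet_form_sym_part Du :
  dirichlet_form Omega (sym_part A) Du Du = dirichlet_form Omega A Du Du.
Proof. by apply: eq_Rintegral => x _; exact: dot_sym_part. Qed.

Lemma H10_L2 u Du : H10 Omega u Du -> L2on Omega u /\ L2grad Omega Du.
Proof. by move=> [[lu lDu _] _]. Qed.

(** The form is taken on pairs of a function and its gradient.  The infimum of the
    Rayleigh quotient is an eigenvalue, hence at least the least one. *)
Lemma rayleigh_first_eigenvalue (lambda1 : R) u Du :
  first_dirichlet_eigenvalue Omega (sym_part A) lambda1 -> H10 Omega u Du ->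
  lambda1 * \int[leb]_(x in Omega) (u x * u x) <=
  dirichlet_form Omega (sym_part A) Du Du.
Proof.
move=> [_ lambda1_le] Hu.
have [K K0 AK] := elliptic_bounded_coefficients.
have BK := sym_part_bounded_coefficients K0 AK.
have [_ [alpha alpha0 ellA]] := A_elliptic.
set B := sym_part A in BK *.
have ell : \forall x \ae leb, Omega x ->
    forall xi, alpha * dot xi xi <= dot (B x *m xi) xi.
  by apply: filterS ellA => x ell Ox xi; rewrite dot_sym_part; exact: ell.
have form_ge0 Dv : L2grad Omega Dv -> 0 <= dirichlet_form Omega B Dv Dv.
  move=> lv. apply: le_trans (dirichlet_form_coercive K0 BK lv ell).
  apply: mulr_ge0; first exact: ltW.
  by apply: sumr_ge0 => i _; apply: Rintegral_ge0 => x _; rewrite -expr2 sqr_ge0.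
rewrite Rintegral_restrict_mul.
have [lu lDu] := H10_L2 Hu.
(* If u = 0 a.e., there need not be a nonzero vector to start from. *)
have [u0|u_neq0] := eqVneq (ip leb (u \_ Omega) (u \_ Omega)) 0.
  by rewrite u0 mulr0; exact: form_ge0.
pose V : lmodType R := ((T -> R) * (T -> 'cV[R]_n.+1))%type.
pose H : set V := [set w | H10 Omega w.1 w.2].
pose q (w z : V) : R := dirichlet_form Omega B w.2 z.2.
pose m (w z : V) : R := ip leb (w.1 \_ Omega) (z.1 \_ Omega).
have HL w : H w -> L2on Omega w.1 /\ L2grad Omega w.2 by exact: H10_L2.
have sH : subspace H.
  have lin a (w z : V) : H w -> H z -> H (a *: w + z) by exact: H10_lin.
  (* The zero pair is obtained as a combination of a known element. *)
  split=> //; have := lin (-1) (u, Du) (u, Du) Hu Hu.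
  by rewrite scaleN1r addNr.
have pq : psd_form H q.
  split=> [a w z y /HL[_ lw] /HL[_ lz] /HL[_ ly]|w z /HL[_ lw] /HL[_ lz]|w /HL[_ lw]].
  - exact: (dirichlet_form_linl K0 BK).
  - apply: (dirichlet_form_sym lw lz) => x i j.
    by rewrite /B !sym_partE addrC.
  - exact: form_ge0.
have pm : psd_form H m.
  have [lin sym ge0] := ip_psd leb.
  split=> [a w z y /HL[lw _] /HL[lz _] /HL[ly _]|w z /HL[lw _] /HL[lz _]|w /HL[lw _]].
  - by rewrite /m restrict_lin; exact: lin.
  - exact: sym.
  - exact: ge0.
have grad_le (Dw : T -> 'cV[R]_n.+1) i : L2grad Omega Dw ->
    ip leb ((fun x => Dw x i ord0) \_ Omega) ((fun x => Dw x i ord0) \_ Omega) <=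
    alpha^-1 * dirichlet_form Omega B Dw Dw.
  move=> lw; rewrite ler_pdivlMl//.
  apply: le_trans (dirichlet_form_coercive K0 BK lw ell).
  rewrite ler_wpM2l ?(ltW alpha0)// /gradsq (bigD1 i)//= lerDl.
  by apply: sumr_ge0 => j _; apply: Rintegral_ge0 => x _; rewrite -expr2 sqr_ge0.
have sqdist_m (w z : V) : sqdist Omega w.1 z.1 = m (w - z) (w - z) by [].
have compactH (w : nat -> V) (C : R) : (forall k, H (w k)) ->
    (forall k, q (w k) (w k) + m (w k) (w k) <= C) ->
    exists2 s : nat -> nat, (forall k, k <= s k)%N &
    forall e : R, 0 < e -> exists N, forall i j, (N <= i)%N -> (N <= j)%N ->
      m (w (s i) - w (s j)) (w (s i) - w (s j)) <= e.
  move=> Hw wC.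
  have q0 k : 0 <= q (w k) (w k) by case: pq => _ _; exact.
  have m0 k : 0 <= m (w k) (w k) by case: pm => _ _; exact.
  have C0 : 0 <= C by apply: le_trans (wC 0%N); exact: addr_ge0.
  have a0 : 0 < alpha^-1 by rewrite invr_gt0.
  apply: (@H10_precompact _ _ _ Omega_bounded (C + alpha^-1 * C)
    (fun k => (w k).1) (fun k => (w k).2)) => //.
  - move=> k; apply: (@le_trans _ _ C); last by rewrite lerDl mulr_ge0// ltW.
    by apply: le_trans (wC k); rewrite lerDr.
  - move=> k i; have [_ lw] := HL _ (Hw k).
    apply: le_trans (grad_le _ i lw) _.
    apply: (@le_trans _ _ (alpha^-1 * C)); last by rewrite lerDr.
    by rewrite ler_wpM2l ?(ltW a0)//; apply: le_trans (wC k); rewrite lerDl.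
have completeH (w : nat -> V) : (forall k, H (w k)) ->
    (forall e : R, 0 < e -> exists N, forall i j, (N <= i)%N -> (N <= j)%N ->
      q (w i - w j) (w i - w j) + m (w i - w j) (w i - w j) <= e) ->
    exists2 z, H z & forall e : R, 0 < e -> exists N, forall k, (N <= k)%N ->
      q (w k - z) (w k - z) + m (w k - z) (w k - z) <= e.
  move=> Hw cw.
  have [|z [Dz [Hz zP]]] := @H10_complete _ _ _ Omega_open Omega_bounded
      (fun k => (w k).1) (fun k => (w k).2) Hw.
    move=> e e0; pose d := e / (1 + alpha^-1).
    have a0 : 0 < alpha^-1 by rewrite invr_gt0.
    have a1 : 0 < 1 + alpha^-1 by rewrite addr_gt0.
    have d0 : 0 < d by rewrite divr_gt0.
    have de : d <= e by rewrite /d ler_pdivrMr// mulrDr mulr1 lerDl mulr_ge0// ltW.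
    have ade : alpha^-1 * d <= e.
      rewrite /d mulrA ler_pdivrMr// mulrC mulrDr mulr1 lerDr. exact: ltW.
    have [N NP] := cw _ d0; exists N => i j Ni Nj; have := NP _ _ Ni Nj.
    have Hd := subspaceB sH (Hw i) (Hw j).
    have q0 : 0 <= q (w i - w j) (w i - w j) by case: pq => _ _; exact.
    have m0 : 0 <= m (w i - w j) (w i - w j) by case: pm => _ _; exact.
    move=> le_d; split=> [|l].
      by rewrite sqdist_m; apply: le_trans de; apply: le_trans le_d; rewrite lerDr.
    apply: le_trans ade; have [_ ld] := HL _ Hd.
    have := grad_le _ l ld; rewrite -/(q (w i - w j) (w i - w j)) => g_le.
    have -> : sqdist Omega (fun x => (w i).2 x l ord0) (fun x => (w j).2 x l ord0) =
        ip leb ((fun x => (w i - w j).2 x l ord0) \_ Omega)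
               ((fun x => (w i - w j).2 x l ord0) \_ Omega).
      rewrite /sqdist (_ : _ \- _ = fun x => (w i - w j).2 x l ord0)//.
      by apply/funext => x; rewrite /= !fctE !mxE.
    apply: le_trans g_le _; rewrite ler_wpM2l ?(ltW a0)//.
    by apply: le_trans le_d; rewrite lerDl.
  (* D bounds the form plus the squared norm by the componentwise distances. *)
  exists (z, Dz) => // e e0; pose D := n.+1%:R * (K ^+ 2 + 1) * n.+1%:R + 1 : R.
  have D1 : 0 < D.
    by rewrite ltr_wpDl// mulr_ge0// mulr_ge0// addr_ge0// sqr_ge0.
  have [N NP] := zP _ (divr_gt0 e0 D1); exists N => k Nk; have [d1 d2] := NP _ Nk.
  have Hd := subspaceB sH (Hw k) (Hz : H (z, Dz)).
  have [_ ld] := HL _ Hd.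
  have := dirichlet_form_le K0 BK ld.
  have : gradsq Omega (w k - (z, Dz)).2 <= n.+1%:R * (e / D).
    rewrite /gradsq mulr_natl -[X in _ *+ X](card_ord n.+1) -sumr_const.
    apply: ler_sum => l _; apply: le_trans (d2 l).
    rewrite /sqdist (_ : _ \- _ = fun x => (w k - (z, Dz)).2 x l ord0)//.
    by apply/funext => x; rewrite /= !fctE !mxE.
  rewrite -/(q _ _) => g_le q_le.
  have {}d1 : m (w k - (z, Dz)) (w k - (z, Dz)) <= e / D by rewrite -sqdist_m.
  have eE : e = n.+1%:R * (K ^+ 2 + 1) * (n.+1%:R * (e / D)) + e / D.
    have : e = D * (e / D) by rewrite mulrC divfK// gt_eqF.
    by move: (e / D) => t ->; rewrite /D; ring.
  rewrite [leRHS]eE.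
  apply: lerD d1; apply: le_trans q_le _.
  by rewrite ler_wpM2l// mulr_ge0// addr_ge0// sqr_ge0.
have upos : exists2 x, H x & 0 < m x x.
  exists (u, Du) => //; rewrite lt0r u_neq0.
  by case: (ip_psd leb) => _ _; apply.
have [mu [[e De] [He me qe mu_le]]] :=
  rayleigh_quotient_eigenvector sH pq pm compactH completeH upos.
apply: le_trans (mu_le (u, Du) Hu); rewrite ler_wpM2r//.
  by case: (ip_psd leb) => _ _; apply.
apply: lambda1_le; exists e, De; split=> // [e0|phi Dphi Hphi].
  move: me; rewrite /m /= /ip /Rintegral.
  rewrite (ae_eq_integral (cst 0%E)).
  - by rewrite integral0 ltxx.
  - exact: measurableT.
  - by have [le _] := HL _ He; have /integrableP[] := L2_integrable_mul le le.
  - exact: measurable_cst.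
  - apply: filterS e0 => x e0 _; rewrite patchE; case: ifPn => //= xO.
    by rewrite e0 ?mul0r//; rewrite inE in xO.
  by rewrite mul0r.
by rewrite Rintegral_restrict_mul; exact: (qe (phi, Dphi) Hphi).
Qed.

End rayleigh_dirichlet.

(** * Caratheodory functions and an extended-real inequality *)

Section complete_measure.
Context d d' (T : measurableType d) (U : measurableType d') (R : realType).
Variable mu : {measure set T -> \bar R}.

(** In a complete measure space a function which agrees almost everywhere with a
    measurable one is measurable. *)
Lemma complete_ae_measurable (D : set T) (f g : T -> U) :
  measure_is_complete mu -> measurable D -> measurable_fun D f ->
  f = g %[ae mu in D] -> measurable_fun D g.
Proof.
move=> cmu mD mf [N [mN N0 subN]] _ Y mY.
have -> : D `&` g @^-1` Y = (D `&` f @^-1` Y) `\` N `|` (D `&` g @^-1` Y `&` N).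
  have fgE x : D x -> ~ N x -> f x = g x.
    by move=> Dx Nx; apply: contrapT => nfg; apply/Nx/subN => /= /(_ Dx).
  apply/seteqP; split=> [x [Dx gY]|x].
    have [Nx|Nx] := pselect (N x); [by right|left].
    by split=> //; split=> //=; rewrite fgE.
  move=> [[[Dx fY] Nx]|[]//]; split=> //=; rewrite -fgE//.
apply: measurableU; first by apply: measurableD => //; exact: mf.
by apply: cmu; exists N; split=> // x [].
Qed.

End complete_measure.

Section caratheodory_composition.
Context d (T : measurableType d) (R : realType).
Variable mu : {measure set T -> \bar R}.
Hypothesis cmu : measure_is_complete mu.
Variables (Omega : set T) (F : T -> R -> \bar R).
Hypotheses (mOmega : measurable Omega)
  (F_cont : \forall x \ae mu, Omega x -> {within `[0, +oo[, continuous (F x)})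
  (F_meas : forall s : R, 0 <= s -> measurable_fun Omega (F ^~ s)).

Lemma within_continuous_cvg (f : R -> \bar R) (w : R) (q : nat -> R) :
  {within `[0, +oo[, continuous f} -> 0 <= w -> (forall k, 0 <= q k) ->
  q k @[k --> \oo] --> w -> f (q k) @[k --> \oo] --> f w.
Proof.
move=> cf w0 q0 qw.
have wA : `[0, +oo[%classic w by rewrite /= in_itv/= w0.
have fw : f @ within `[0, +oo[ (nbhs w) --> f w.
  by rewrite (nbhs_subspace_in wA); exact: cf.
move=> V fV; have [N _ NP] := qw _ (fw V fV).
by exists N => // k Nk; apply: (NP k Nk); rewrite /= in_itv/= q0.
Qed.

(** Approximate [w] from below by functions [q k] with countably many values. *)
Lemma caratheodory_measurable_comp (w : T -> R) : measurable_fun setT w ->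
  (forall x, 0 <= w x) -> measurable_fun Omega (fun x => F x (w x)).
Proof.
move=> mw w0.
pose j k x := Num.truncn (k.+1%:R * w x).
pose q k x : R := (j k x)%:R / k.+1%:R.
have jP k x : (j k x)%:R <= k.+1%:R * w x < (j k x).+1%:R.
  by apply: truncn_itv; rewrite mulr_ge0.
have q0 k x : 0 <= q k x by rewrite divr_ge0.
have q_cvg x : q k x @[k --> \oo] --> w x.
  apply/cvgrPdist_le => e e0.
  have [N _ NP] := near_infty_natSinv_lt (PosNum e0).
  exists N => // k Nk; have /andP[lo hi] := jP k x.
  apply: le_trans (ltW (NP k Nk)).
  have -> : w x - q k x = (k.+1%:R * w x - (j k x)%:R) / k.+1%:R.
    by rewrite mulrBl mulrAC mulfV// mul1r.
  rewrite ger0_norm; last by rewrite divr_ge0// subr_ge0.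
  by rewrite ler_pdivrMr// mulVf// lerBlDl natr1 ltW.
have mFq k : measurable_fun Omega (fun x => F x (q k x)).
  move=> _ Y mY.
  have -> : Omega `&` (fun x => F x (q k x)) @^-1` Y = \bigcup_i
      ((Omega `&` (F ^~ (i%:R / k.+1%:R)) @^-1` Y) `&`
       (w @^-1` `[i%:R / k.+1%:R, i.+1%:R / k.+1%:R[%classic)).
    have itvE i x : (w @^-1` `[i%:R / k.+1%:R, i.+1%:R / k.+1%:R[%classic) x ->
        j k x = i.
      rewrite /= in_itv/= ler_pdivrMr// ltr_pdivlMr// [w x * _]mulrC => wi.
      exact: truncn_def.
    apply/seteqP; split=> [x [Ox FY]|x [i _ [[Ox FY] wi]]].
      exists (j k x) => //; split=> //=.
      rewrite in_itv/= ler_pdivrMr// ltr_pdivlMr// [w x * _]mulrC.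
      exact: jP.
    by split=> //=; rewrite /q (itvE _ _ wi).
  apply: bigcupT_measurable => i; apply: measurableI.
    by apply: F_meas => //; rewrite divr_ge0.
  by rewrite -[X in measurable X]setTI; apply: mw => //; exact: measurable_itv.
have [N [mN N0 subN]] := F_cont.
have mOD : measurable (Omega `\` N) by exact: measurableD.
have mFw : measurable_fun (Omega `\` N) (fun x => F x (w x)).
  apply: (emeasurable_fun_cvg (fun k x => F x (q k x))) => //.
    by move=> k; apply: measurable_funS (mFq k).
  move=> x [Ox Nx]; apply: within_continuous_cvg => //.
  by apply: contrapT => nc; apply/Nx/subN => /= /(_ Ox).
move=> _ Y mY.
have -> : Omega `&` (fun x => F x (w x)) @^-1` Y =
    ((Omega `\` N) `&` (fun x => F x (w x)) @^-1` Y) `|`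
    (Omega `&` (fun x => F x (w x)) @^-1` Y `&` N).
  apply/seteqP; split=> [x [Ox FY]|x].
    by have [Nx|Nx] := pselect (N x); [right|left].
  by move=> [[[]]|[[]]].
apply: measurableU; first exact: mFw.
by apply: cmu; exists N; split=> // x [].
Qed.

End caratheodory_composition.

Section ereal_inequality.
Variable R : realType.
Local Open Scope ereal_scope.

(** No finiteness of [Fa] and [Fb] is required: if [b <= a] and [Fb] is infinite,
    then the right-hand side is infinite unless [a = b = 0]. *)
Lemma almost_nonincreasing_mul_le (lambda a b : R) (Fa Fb : \bar R) :
  (0 <= a)%R -> (0 <= b)%R -> 0 <= Fa -> 0 <= Fb ->
  ((b <= a)%R -> Fa - (lambda * a)%:E <= Fb - (lambda * b)%:E) ->
  ((a <= b)%R -> Fb - (lambda * b)%:E <= Fa - (lambda * a)%:E) ->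
  Fa * a%:E + Fb * b%:E <=
  Fa * b%:E + Fb * a%:E + (lambda * ((a - b) * (a - b)))%:E.
Proof.
wlog ba : a b Fa Fb / (b <= a)%R.
  move=> th a0 b0 Fa0 Fb0 h1 h2; have [ba|/ltW ab] := leP b a.
    exact: th.
  have := th b a Fb Fa ab b0 a0 Fb0 Fa0 h2 h1.
  rewrite [Fb * b%:E + _]addeC [Fb * a%:E + _]addeC.
  by rewrite -[(a - b)%R]opprB mulrNN.
move=> a0 b0 Fa0 Fb0 /(_ ba) h _.
case: Fb Fb0 h => [fb| |]// fb0 h.
  case: Fa Fa0 h => [fa| |]// fa0; rewrite -!EFinB lee_fin => h.
  by rewrite -!EFinM -!EFinD lee_fin; nra.
move: a0; rewrite le_eqVlt => /predU1P[a0|a0].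
  have b00 : b = 0%R by apply/eqP; rewrite eq_le b0 andbT a0.
  by rewrite -a0 b00 !mule0 subrr !mulr0 !adde0.
rewrite [+oo * a%:E]mulyr gtr0_sg// mul1e addey; last first.
  by rewrite gt_eqF// (lt_le_trans ltNy0)// mule_ge0.
by rewrite addye ?leey.
Qed.

End ereal_inequality.

(** * Energy identities and uniqueness *)

Section singular_problem.
Variables (R : realType) (n : nat).
Local Notation T := 'rV[R]_n.+1.
Local Notation leb := (@lebesgue_rV R n).
Variables (Omega : set T) (A : T -> 'M[R]_n.+1) (F : T -> R -> \bar R).
Hypotheses (Omega_open : open Omega) (Omega_bounded : bounded_set Omega)
  (F_caratheodory : caratheodory_nonlinearity Omega F).
Let mOmega : measurable Omega := open_measurable_rV Omega_open.

(** The reaction term F(x,u), made nonnegative everywhere on [Omega] by cutting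
    off the negative values of [u], which only occur on a null set. *)
Definition reaction (u : T -> R) (x : T) : \bar R :=
  F x (Num.max 0 ((u \_ Omega) x)).

Lemma reaction_ge0 u x : Omega x -> (0 <= reaction u x)%E.
Proof.
by have [F0 _ _] := F_caratheodory; move=> Ox; apply: F0 => //; rewrite le_max lexx.
Qed.

Lemma cutoff_measurable u : L2on Omega u ->
  measurable_fun setT (fun x => Num.max 0 ((u \_ Omega) x)).
Proof.
by move=> lu; apply: measurable_maxr; [exact: measurable_cst|exact: (L2_measurable lu)].
Qed.

Lemma reaction_measurable u : L2on Omega u -> measurable_fun Omega (reaction u).
Proof.
have [_ cF mF] := F_caratheodory; move=> lu.
apply: (caratheodory_measurable_comp (@lebesgue_rV_complete R n) mOmega cF mF).
  exact: cutoff_measurable.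
by move=> x; rewrite le_max lexx.
Qed.

(** The integrand F(x,u) phi of the equation, with the negative values of [u] and
    [phi] cut off. *)
Definition energy_density (u phi : T -> R) (x : T) : \bar R :=
  (reaction u x * (Num.max 0 ((phi \_ Omega) x))%:E)%E.

Lemma energy_density_ge0 u phi x : Omega x -> (0 <= energy_density u phi x)%E.
Proof.
by move=> Ox; apply: mule_ge0; [exact: reaction_ge0|rewrite lee_fin le_max lexx].
Qed.

Lemma energy_density_measurable u phi : L2on Omega u -> L2on Omega phi ->
  measurable_fun Omega (energy_density u phi).
Proof.
move=> lu lphi; apply: emeasurable_funM; first exact: reaction_measurable.
apply/measurable_EFinP.
exact: (measurable_funS measurableT (@subsetT _ _) (cutoff_measurable lphi)).
Qed.

Lemma integral_energy_density u phi : L2on Omega u -> L2on Omega phi ->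
  (\forall x \ae leb, Omega x -> 0 <= u x) ->
  (\forall x \ae leb, Omega x -> 0 <= phi x) ->
  (\int[leb]_(x in Omega) (F x (u x) * (phi x)%:E) =
   \int[leb]_(x in Omega) energy_density u phi x)%E.
Proof.
move=> lu lphi u0 phi0.
have eq_ae : energy_density u phi = (fun x => F x (u x) * (phi x)%:E)%E
    %[ae leb in Omega].
  apply: filterS2 u0 phi0 => x ux phix Ox.
  rewrite /energy_density /reaction !patchE mem_set//.
  by rewrite !max_r ?ux ?phix.
have mE := energy_density_measurable lu lphi.
apply/esym; apply: ae_eq_integral.
- exact: mOmega.
- exact: mE.
- exact: (complete_ae_measurable (@lebesgue_rV_complete R n) mOmega mE eq_ae).
- exact: eq_ae.
Qed.

Lemma solution_energy_identity u v Du Dv :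
  H10 Omega u Du -> (\forall x \ae leb, Omega x -> 0 <= u x) ->
  H10 Omega v Dv -> (\forall x \ae leb, Omega x -> 0 <= v x) ->
  (forall phi Dphi, H10 Omega phi Dphi ->
    (\forall x \ae leb, Omega x -> 0 <= phi x) ->
    (\int[leb]_(x in Omega) (F x (u x) * (phi x)%:E) < +oo)%E /\
    ((dirichlet_form Omega A Du Dphi)%:E =
      \int[leb]_(x in Omega) (F x (u x) * (phi x)%:E))%E) ->
  (\int[leb]_(x in Omega) energy_density u v x)%E =
  (dirichlet_form Omega A Du Dv)%:E.
Proof.
move=> Hu u0 Hv v0 /(_ v Dv Hv v0)[_ ->].
by rewrite integral_energy_density//; [case: (H10_L2 Hu)|case: (H10_L2 Hv)].
Qed.

End singular_problem.

Theorem theorem4p4 (R : realType) (n : nat) (Omega : set 'rV[R]_n.+1)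
    (A : 'rV[R]_n.+1 -> 'M[R]_n.+1) (F : 'rV[R]_n.+1 -> R -> \bar R)
    (lambda1 lambda : R)
    (Omega_open : open Omega) (Omega_bounded : bounded_set Omega)
    (A_elliptic : bounded_elliptic Omega A)
    (F_caratheodory : caratheodory_nonlinearity Omega F)
    (F_growth : singular_growth Omega F)
    (lambda1_first : first_dirichlet_eigenvalue Omega (sym_part A) lambda1)
    (lambda_ge0 : 0 <= lambda) (lambda_lt : lambda < lambda1)
    (F_almost_nonincreasing : almost_nonincreasing Omega F lambda)
    (u v : 'rV[R]_n.+1 -> R) :
  solution Omega A F u -> solution Omega A F v ->
  u = v %[ae (@lebesgue_rV R n) in Omega].
Proof.
move=> [Du [Hu u0 eqU]] [Dv [Hv v0 eqV]].
have mOmega := open_measurable_rV Omega_open.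
have [lu lDu] := H10_L2 Hu; have [lv lDv] := H10_L2 Hv.
pose z := (-1) *: v + u; pose Dz := (-1) *: Dv + Du.
have Hz : H10 Omega z Dz by exact: H10_lin.
have [lz lDz] := H10_L2 Hz.
have zE x : (z \_ Omega) x = (u \_ Omega) x - (v \_ Omega) x.
  by rewrite /z restrict_lin addrC -[LHS]/(_ + (-1) * _) mulN1r.
have [K K0 AK] := elliptic_bounded_coefficients A_elliptic.
pose form := dirichlet_form Omega A.
have formz : form Dz Dz = form Du Du + form Dv Dv - form Du Dv - form Dv Du.
  rewrite /form /Dz (dirichlet_form_linl K0 AK (-1) lDv lDu lDz).
  rewrite (dirichlet_form_linr K0 AK (-1) lDv lDu lDv).
  rewrite (dirichlet_form_linr K0 AK (-1) lDv lDu lDu); ring.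
pose Z x := (lambda * ((z \_ Omega) x * (z \_ Omega) x))%:E.
have Z0 x : (0 <= Z x)%E by rewrite lee_fin mulr_ge0// -expr2 sqr_ge0.
have intZ : (@lebesgue_rV R n).-integrable setT Z.
  exact: (integrableZl measurableT lambda (L2_integrable_mul lz lz)).
have mZ : measurable_fun Omega Z.
  by have /integrableP[mZ _] := intZ; exact: measurable_funS mZ.
have intZE : (\int[@lebesgue_rV R n]_(x in Omega) Z x =
    (lambda * ip (@lebesgue_rV R n) (z \_ Omega) (z \_ Omega))%:E)%E.
  have mz2 : measurable_fun setT (EFin \o (fun x => (z \_ Omega) x ^+ 2)).
    by have /integrableP[] := L2_integrable_sqr lz.
  rewrite integral_mkcond EFinM (ipE lz).
  rewrite -(ge0_integralZl (@lebesgue_rV R n) measurableT mz2).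
  - apply: eq_integral => x _; rewrite /Z -EFinM patchE expr2.
    case: ifPn => // xO; rewrite patchE (negbTE xO) !mulr0; reflexivity.
  - by move=> x _; rewrite lee_fin sqr_ge0.
  - by rewrite lee_fin.
pose E := energy_density Omega F.
have mE f g : L2on Omega f -> L2on Omega g -> measurable_fun Omega (E f g).
  exact: energy_density_measurable.
have E0 f g x : Omega x -> (0 <= E f g x)%E by exact: energy_density_ge0.
have pointwise : \forall x \ae (@lebesgue_rV R n), Omega x ->
    (E u u x + E v v x <= E u v x + E v u x + Z x)%E.
  apply: filterS3 F_almost_nonincreasing u0 v0 => x mono ux vx Ox.
  have {}ux := ux Ox; have {}vx := vx Ox; have {}mono := mono Ox.
  have [F0 _ _] := F_caratheodory.
  rewrite /E /energy_density /reaction /Z zE !patchE mem_set// !max_r//.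
  apply: almost_nonincreasing_mul_le => //; try exact: F0.
  - by move=> vu; apply: mono; rewrite vx vu.
  - by move=> uv; apply: mono; rewrite ux uv.
have : (\int[@lebesgue_rV R n]_(x in Omega) (E u u x + E v v x) <=
    \int[@lebesgue_rV R n]_(x in Omega) (E u v x + E v u x + Z x))%E.
  apply: ae_ge0_le_integral.
  - exact: mOmega.
  - by move=> x Ox; apply: adde_ge0; exact: E0.
  - by apply: emeasurable_funD; exact: mE.
  - by move=> x Ox; apply: adde_ge0 (Z0 x); apply: adde_ge0; exact: E0.
  - by apply: emeasurable_funD mZ; apply: emeasurable_funD; exact: mE.
  - exact: pointwise.
rewrite (ge0_integralD (@lebesgue_rV R n) mOmega (E0 u u) (mE _ _ lu lu)
  (E0 v v) (mE _ _ lv lv)).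
rewrite (ge0_integralD (@lebesgue_rV R n) mOmega _ _ (fun x _ => Z0 x) mZ);
  last 2 first.
- by move=> x Ox; apply: adde_ge0; exact: E0.
- by apply: emeasurable_funD; exact: mE.
rewrite (ge0_integralD (@lebesgue_rV R n) mOmega (E0 u v) (mE _ _ lu lv)
  (E0 v u) (mE _ _ lv lu)).
have id f g Df Dg := @solution_energy_identity R n Omega A F Omega_open
  F_caratheodory f g Df Dg.
rewrite (id u u Du Du Hu u0 Hu u0 eqU) (id v v Dv Dv Hv v0 Hv v0 eqV).
rewrite (id u v Du Dv Hu u0 Hv v0 eqU) (id v u Dv Du Hv v0 Hu u0 eqV) intZE.
rewrite -!EFinD lee_fin => energy.
have := rayleigh_first_eigenvalue Omega_open Omega_bounded A_elliptic
  lambda1_first Hz.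
rewrite dirichlet_form_sym_part Rintegral_restrict_mul -/(form _ _) formz.
set N := ip _ _ _ => rayleigh.
have N0 : 0 <= N by case: (ip_psd (@lebesgue_rV R n)) => _ _; apply.
have Nz : N = 0.
  apply/eqP; rewrite eq_le N0 andbT.
  rewrite -(pmulr_rle0 _ (_ : 0 < lambda1 - lambda)) ?subr_gt0// mulrBl.
  by move: energy; rewrite -/N /form in rayleigh *; lra.
have := ip_eq0 lz Nz; apply: filterS => x; rewrite zE => uv Ox.
by apply/eqP; rewrite -subr_eq0; move: uv; rewrite !patchE mem_set// => ->.
Qed.
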